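(* Let $d=2$, $\Gamma=[0,1]^2$, $\alpha\in(0,\infty)$, $\eta\in(0,1]$. Suppose that $\phi_n \in\Phi_{2,\eta} \cap\Psi_2$ for all $n$, and set $p_n:=\mu(\phi_n)$, $r_n:=\rho_\eta(\phi_n)$, with $r_n=n^{-\Omega(1)}$. Suppose $p_n = \Theta(1/ \log n)$ and $$n I(\phi_n) = \log n -2 \log\gamma_n + o(1),$$ where $\gamma_n$ denotes the solution in $(0,\infty)$ to $$\gamma_n^2 + 2 \gamma_n \bigl(J_2(\phi_n)^{1/2}/J_1(\phi_n)\bigr) (p_n \log n)^{-1/2} = \alpha.$$ Then, as $n\to\infty$, $$n \int_{\Gamma} \exp \Bigl(- n \int_\Gamma \phi_n(y-x) \,dy \Bigr) \,dx \to\alpha .$$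
   Context: $|\cdot|$ is the Euclidean norm on $\mathbb{R}^2$. A connection function on $\mathbb{R}^2$ is a measurable $\phi:\mathbb{R}^2\to[0,1]$ with $\phi(x)=\phi(-x)$ for all $x$. Put $\mu(\phi)=\sup_{x}\phi(x)$ and $\rho_\eta(\phi)=\inf\{|x|: x\in\mathbb{R}^2,\ \phi(x)<\eta\mu(\phi)\}$. $\Psi_2$ is the class of connection functions on $\mathbb{R}^2$ with $\phi(x)\ge\phi(y)$ whenever $|x|\le|y|$. $\Phi_{2,\eta}$ is the class of connection functions $\phi$ on $\mathbb{R}^2$ with $\rho_\eta(\phi)\in(0,\infty)$ and $\phi(x)\le 3\eta^{-1}\mu(\phi)\exp(-\eta(|x|/\rho_\eta(\phi))^\eta)$ for all $x$. Define $$I(\phi)=\int_{\mathbb{R}^2}\phi(x)\,dx,$$ $$J_1(\phi)=\mu(\phi)^{-1}\int_0^\infty\phi\bigl((\rho_\eta(\phi)t,0)\bigr)\,dt,\qquad J_2(\phi)=\mu(\phi)^{-1}\int_0^\infty\phi\bigl((\rho_\eta(\phi)t,0)\bigr)\,2\pi t\,dt .$$ $r_n=n^{-\Omega(1)}$ means that there is a constant $c>0$ with $r_n\le n^{-c}$ for all large $n$; $\Theta$ denotes equality of order up to positive constant factors. *)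

(* Defs.v *)
From HB Require Import structures.
From mathcomp Require Import all_boot all_order all_algebra.
From mathcomp Require Import all_classical all_reals all_analysis.

Set Implicit Arguments.
Unset Strict Implicit.
Unset Printing Implicit Defensive.

Import Order.TTheory GRing.Theory Num.Theory.
Import numFieldNormedType.Exports.

Local Open Scope classical_set_scope.
Local Open Scope ring_scope.

(* The plane is R * R.  The library norm `|x| on R * R is the sup norm, hence
   the explicit Euclidean norm below. *)
Definition enorm2 (R : realType) (x : R * R) : R :=
  Num.sqrt (x.1 ^+ 2 + x.2 ^+ 2).

Definition leb2 (R : realType) :
    {measure set (measurableTypeR R * measurableTypeR R) -> \bar R} :=
  (@lebesgue_measure R \x @lebesgue_measure R)%E.

Definition unit_square (R : realType) : set (R * R) :=
  `[0, 1]%classic `*` `[0, 1]%classic.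

Definition connection_function (R : realType) (phi : R * R -> R) : Prop :=
  [/\ measurable_fun [set: R * R] phi,
      forall x, 0 <= phi x <= 1
    & forall x, phi x = phi (- x)].

Definition conn_sup (R : realType) (phi : R * R -> R) : R := sup (range phi).

(* The infimum is taken in the extended reals, so that the infimum of the
   empty set is +oo. *)
Definition rho_ext (R : realType) (eta : R) (phi : R * R -> R) : \bar R :=
  ereal_inf [set (enorm2 x)%:E | x in [set x | phi x < eta * conn_sup phi]].

(* Only meaningful when rho_ext is finite, as required by the class Phi2. *)
Definition rho (R : realType) (eta : R) (phi : R * R -> R) : R :=
  fine (rho_ext eta phi).

Definition Psi2 (R : realType) (phi : R * R -> R) : Prop :=
  connection_function phi /\
  forall x y, enorm2 x <= enorm2 y -> phi y <= phi x.

Definition Phi2 (R : realType) (eta : R) (phi : R * R -> R) : Prop :=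
  [/\ connection_function phi,
      (0 < rho_ext eta phi < +oo)%E
    & forall x, phi x <= 3 * eta^-1 * conn_sup phi *
        expR (- eta * (enorm2 x / rho eta phi) `^ eta)].

Definition conn_integral (R : realType) (phi : R * R -> R) : R :=
  \int[leb2 R]_x phi x.

Definition J1 (R : realType) (eta : R) (phi : R * R -> R) : R :=
  (conn_sup phi)^-1 *
  \int[@lebesgue_measure R]_(t in `[0, +oo[) phi (rho eta phi * t, 0).

Definition J2 (R : realType) (eta : R) (phi : R * R -> R) : R :=
  (conn_sup phi)^-1 *
  \int[@lebesgue_measure R]_(t in `[0, +oo[)
    (phi (rho eta phi * t, 0) * (2 * pi * t)).

(* Main.v *)
(* Write p, r, I for the supremum of phi, rho and the integral of phi, and W(x)
   for the mass of phi (y - x) over the square.  At distance more than c >> r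
   from the boundary W = I up to a negligible tail; at distance u from one side,
   away from the corners, W is I / 2 plus twice the mass of the strip [0, u] of
   a half-plane, and that mass is u r p J1 up to relative error u / r.  Hence
   n exp (- n I) comes from the interior, while each side contributes
   n exp (- n I / 2) times the integral of exp (- 2 n r p J1 u) over u, that is
   exp (- n I / 2) / (2 r p J1), and the corners are negligible.  Polar
   coordinates give I = r^2 p J2, which eliminates r; the two contributions
   converge to the two terms of the quadratic equation for gamma. *)
Require Import Defs.
From HB Require Import structures.
From mathcomp Require Import all_boot all_order all_algebra.
From mathcomp Require Import all_classical all_reals all_analysis.
From mathcomp Require Import measurable_realfun ring lra.

Set Implicit Arguments.
Unset Strict Implicit.
Unset Printing Implicit Defensive.

Import Order.TTheory GRing.Theory Num.Theory.
Import numFieldNormedType.Exports.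

Local Open Scope classical_set_scope.
Local Open Scope ring_scope.

(** Neither [gamma n], [J1], [J2] nor [p * ln n] need converge, so neither contribution need have a
    limit of its own. Each is matched with its term of the quadratic equation up to factors tending
    to 1, and only the sum, which equals [alpha] for every n > 1, passes to the limit. The geometry
    is reduced to one function: by evenness the window mass is an exact sum of four masses [Q u v]
    of boxes [0, u] x [0, v], and a few inequalities on [Q] suffice. The outer integral is then
    squeezed between combinations of products h(x1) k(x2), which integrate in closed form over the
    whole square. The natural scale is t = sqrt (ln n), as n I is comparable to t^2. Strips are
    linearised up to width r / t and tails are cut at c = t^4 r. A tail then costs O(t^-2) in the
    exponent, the linearisation a relative error O(1 / t), and what is left beyond r / t or in the
    corners is a power of t against an exponentially small factor. The polynomial decay of r forces
    c to 0, and the lower bound on p keeps n r^2 below a power of t. *)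

Section affine.
Context {R : realType}.
Let mu := @lebesgue_measure R.
Local Open Scope ereal_scope.

(** * Linear substitutions on the line and Tonelli on rectangles *)

Lemma ge0_integral_affine (a b : R) (D : set R) (f : R -> \bar R) : (0 < a)%R ->
  measurable D -> measurable_fun D f -> (forall x, 0 <= f x) ->
  \int[mu]_(x in D) f x =
  a%:E * \int[mu]_(x in (fun x : R => a * x + b )%R @^-1` D) f (a * x + b)%R.
Proof.
move=> a0 mD mf f0.
pose g : measurableTypeR R -> measurableTypeR R := fun x => (a * x + b)%R.
have mg : measurable_fun setT g.
  apply: continuous_measurable_fun => x; apply: cvgD; last exact: cvg_cst.
  by apply: cvgM; [exact: cvg_cst|exact: cvg_id].
have an : (0 <= a)%R by exact: ltW.
(* Lebesgue measure is determined by its values on the intervals []u, v]], and [a] times the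
   pushforward of [mu] under [g] gives them their length. The substitution is then the pushforward
   formula, so [f] needs measurability only. *)
have E A : measurable A -> mu A = mscale (NngNum an) (pushforward mu g) A.
  apply: (@lebesgue_measure_unique R (mscale (NngNum an) (pushforward mu g))) => X [[u v]] _ <-/=.
  rewrite /mscale /= /pushforward.
  have -> : g @^-1` `]u, v] = `]((u - b)/a)%R, ((v-b)/a)%R]%classic.
    apply/seteqP; split => x /=; rewrite !in_itv/= /g ltr_pdivrMr// ler_pdivlMr//; lra.
  rewrite !lebesgue_measure_itv/= !lte_fin ltr_pM2r ?invr_gt0// ltrD2r.
  case: ifPn => _; last by rewrite mule0.
  by rewrite -!EFinD -EFinM; congr (_%:E); field; rewrite gt_eqF.
rewrite (@eq_measure_integral _ _ _ _ (mscale (NngNum an) (pushforward mu g)) mu).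
rewrite ge0_integral_mscale//.
by rewrite ge0_integral_pushforward.
by move=> A mA _; exact: E.
Qed.

Lemma ge0_integral_scale (c : R) (f : R -> \bar R) : (0 < c)%R ->
  measurable_fun setT f -> (forall x, 0 <= f x) ->
  \int[mu]_(x in `[0%R, +oo[) f x = c%:E * \int[mu]_(x in `[0%R, +oo[) f (c * x)%R.
Proof.
move=> c0 mf f0; rewrite (@ge0_integral_affine c 0)//; last exact: measurable_funTS.
under eq_integral do rewrite addr0.
congr (_ * integral _ _ _); apply/seteqP; split => x /=;
  by rewrite !in_itv/= !andbT addr0 pmulr_rge0.
Qed.

Lemma ge0_integral_shift (D : set R) (a : R) (f : R -> \bar R) : measurable D ->
  measurable_fun setT f -> (forall x, 0 <= f x) ->
  \int[mu]_(x in D) f x = \int[mu]_(x in (fun x => x + a)%R @^-1` D) f (x + a)%R.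
Proof.
move=> mD mf f0; rewrite (@ge0_integral_affine 1 a)//; last exact: measurable_funTS.
rewrite mul1e; under eq_integral do rewrite mul1r.
by congr (integral _ _ _); apply/seteqP; split => x /=; rewrite mul1r.
Qed.

Lemma ge0_integral_reflect (D : set R) (f : R -> \bar R) : measurable D ->
  measurable_fun setT f -> (forall x, 0 <= f x) ->
  \int[mu]_(x in D) f x = \int[mu]_(x in (-%R : R -> R) @^-1` D) f (- x)%R.
Proof.
move=> mD mf f0.
rewrite -[RHS](@ge0_integral_pushforward _ _ _ _ R (-%R : measurableTypeR R -> measurableTypeR R))//.
  by apply: eq_measure_integral => //= A mA AS; exact/esym/lebesgue_measureN.
exact: measurable_funTS.
Qed.

Lemma ge0_integral_even_itv (u v : R) (f : R -> \bar R) : (0 <= u)%R -> (0 <= v)%R ->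
  measurable_fun setT f -> (forall x, 0 <= f x) -> (forall x, f (- x)%R = f x) ->
  \int[mu]_(x in `[(- u)%R, v]) f x =
  \int[mu]_(x in `[0%R, u]) f x + \int[mu]_(x in `[0%R, v]) f x.
Proof.
move=> u0 v0 mf f0 fe.
have -> : `[(- u)%R, v]%classic = `[(- u)%R, 0%R[%classic `|` `[0%R, v]%classic.
  apply/seteqP; split => x /=; rewrite !in_itv/=.
    by case: (ltP x 0%R) => x0 /andP[-> ?]; [left|right].
  by case=> /andP[] *; apply/andP; split => //; lra.
rewrite ge0_integral_setU//.
- rewrite integral_itv_bndo_bndc; last exact: measurable_funTS.
  congr (_ + _); rewrite ge0_integral_reflect//.
  under [RHS]eq_integral do rewrite fe.
  congr (integral _ _ _); apply/seteqP; split => x /=; rewrite !in_itv/= => /andP[? ?];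
  by apply/andP; split; lra.
- exact: measurable_funTS.
- by apply/disj_setPS => x /= []; rewrite !in_itv/= => /andP[? ?] /andP[? ?]; lra.
Qed.

Lemma ge0_integral_evenT (f : R -> \bar R) :
  measurable_fun setT f -> (forall x, 0 <= f x) -> (forall x, f (- x)%R = f x) ->
  \int[mu]_x f x =
  \int[mu]_(x in `[0%R, +oo[) f x + \int[mu]_(x in `[0%R, +oo[) f x.
Proof.
move=> mf f0 fe.
have -> : [set: R] = `]-oo, 0%R[%classic `|` `[0%R, +oo[%classic.
  apply/seteqP; split => x //= _; rewrite !in_itv/= andbT.
  by case: (ltP x 0%R) => x0; [left|right].
rewrite ge0_integral_setU//.
- rewrite integral_itv_bndo_bndc; last exact: measurable_funTS.
  congr (_ + _); rewrite ge0_integral_reflect//.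
  under [RHS]eq_integral do rewrite fe.
  congr (integral _ _ _); apply/seteqP; split => x /=; rewrite !in_itv/= ?andbT;
  by rewrite oppr_ge0.
- exact: measurable_funTS.
- by apply/disj_setPS => x /= []; rewrite !in_itv/= => ? /andP[? ?]; lra.
Qed.

Let T := measurableTypeR R.

Lemma integral_setX (A B : set R) (f : T * T -> \bar R) : measurable A -> measurable B ->
  measurable_fun setT f -> (forall x, 0 <= f x) ->
  \int[leb2 R]_(z in A `*` B) f z = \int[mu]_(x in A) \int[mu]_(y in B) f (x, y).
Proof.
move=> mA mB mf f0; rewrite integral_mkcond.
have mAB : measurable (A `*` B : set (T * T)) by exact: measurableX.
transitivity (\int[mu]_x fubini_F mu (f \_ (A `*` B)) x).
  apply: (@fubini_tonelli1 _ _ _ _ _ mu mu); last by move=> x; exact: erestrict_ge0.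
  exact/(measurable_restrictT _ _).1/measurable_funTS.
rewrite [RHS]integral_mkcond; apply: eq_integral => x _; rewrite /fubini_F /patch.
case: ifPn => xA.
  rewrite [RHS]integral_mkcond; apply: eq_integral => y _ /=; rewrite /patch.
  by rewrite in_setX/= xA.
by apply: integral0_eq => y _; rewrite in_setX/= (negbTE xA).
Qed.

Lemma tonelli_setX (A B : set R) (f : T * T -> \bar R) : measurable A -> measurable B ->
  measurable_fun setT f -> (forall x, 0 <= f x) ->
  \int[mu]_(x in A) \int[mu]_(y in B) f (x, y) = \int[mu]_(y in B) \int[mu]_(x in A) f (x, y).
Proof.
move=> mA mB mf f0; rewrite -integral_setX// integral_mkcond.
have mAB : measurable (A `*` B : set (T * T)) by exact: measurableX.
transitivity (\int[mu]_x fubini_G mu (f \_ (A `*` B)) x).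
  apply: (@fubini_tonelli2 _ _ _ _ _ mu mu); last by move=> x; exact: erestrict_ge0.
  exact/(measurable_restrictT _ _).1/measurable_funTS.
rewrite [RHS]integral_mkcond; apply: eq_integral => y _; rewrite /fubini_G /patch.
case: ifPn => yB.
  rewrite [RHS]integral_mkcond; apply: eq_integral => x _ /=; rewrite /patch.
  by rewrite in_setX/= yB andbT.
by apply: integral0_eq => x _; rewrite in_setX/= (negbTE yB) andbF.
Qed.

(** The parameter space is arbitrary so that the lemma can be iterated, integrating out one real
    variable at a time. *)
Lemma measurable_section_integral d1 (T1 : measurableType d1) (B : set R)
  (f : T1 * T -> \bar R) : measurable B ->
  measurable_fun setT f -> (forall x, 0 <= f x) ->
  measurable_fun setT (fun x : T1 => \int[mu]_(y in B) f (x, y)).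
Proof.
move=> mB mf f0.
have mTB : measurable (setT `*` B : set (T1 * T)) by exact: measurableX.
rewrite (_ : (fun x => _) = fubini_F mu (f \_ (setT `*` B))).
  apply: measurable_fun_fubini_tonelli_F; last by move=> x; exact: erestrict_ge0.
  exact/(measurable_restrictT _ _).1/measurable_funTS.
apply/funext => x; rewrite /fubini_F [LHS]integral_mkcond; apply: (@eq_integral _ _ _ mu) => y _.
by rewrite /patch/= in_setX/= in_setT.
Qed.
End affine.

(** * Polar coordinates on a quadrant *)

Section polar.
Context {R : realType}.
Let mu := @lebesgue_measure R.
Let T := measurableTypeR R.
Local Open Scope ereal_scope.

(* Substituting b = a u in the inner integral turns the quadrant into the
   product of the half-line in u, which contributes the integral of
   1 / (1 + u^2), and of the half-line in t = a * sqrt (1 + u^2). *)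
Lemma polar_quadrant (f : T * T -> \bar R) :
  measurable_fun setT f -> (forall x, 0 <= f x) ->
  (forall x y, enorm2 x = enorm2 y -> f x = f y) ->
  \int[mu]_(a in `[0%R, +oo[) \int[mu]_(b in `[0%R, +oo[) f (a, b) =
  (pi / 2)%:E * \int[mu]_(t in `[0%R, +oo[) (t%:E * f (t, 0%R)).
Proof.
move=> mf f0 fr.
have mid : measurable_fun setT (fun z : T * T => z.1%:E).
  by apply/measurable_EFinP; exact: measurable_fst.
have msec : measurable_fun setT (fun t : T => f (t, 0%R)).
  by apply: (measurableT_comp mf); apply: measurable_fun_pair.
(* [|t|] instead of [t] keeps the integrand nonnegative on the whole line, as the scaling lemma
   demands; the two agree on the half-line. *)
pose tf := fun t : T => `|t|%:E * f (t, 0%R).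
have mtf : measurable_fun setT tf.
  by apply: emeasurable_funM => //; apply/measurable_EFinP; exact: normr_measurable.
have tf0 t : 0 <= tf t by rewrite mule_ge0.
have mg : measurable_fun setT (fun z : T * T => `|z.1|%:E * f (z.1, z.1 * z.2)%R).
  apply: emeasurable_funM.
    apply/measurable_EFinP; apply: measurableT_comp => //; exact: measurable_fst.
  apply: (measurableT_comp mf); apply: measurable_fun_pair; first exact: measurable_fst.
  by apply: measurable_funM; [exact: measurable_fst|exact: measurable_snd].
(* The null point [a = 0] is removed because the scaling by [a] needs [a > 0]; it is put back before
   Tonelli is applied. *)
rewrite -integral_itv_obnd_cbnd; last first.
  by apply: measurable_funTS; exact: measurable_section_integral.
transitivity (\int[mu]_(a in `]0%R, +oo[) \int[mu]_(u in `[0%R, +oo[) (`|a|%:E * f (a, a * u)%R)).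
  apply: eq_integral => a; rewrite inE/= in_itv/= andbT => a0.
  rewrite (@ge0_integral_scale _ a)//; last exact: measurableT_comp.
  rewrite [in RHS]ge0_integralZl//.
    by rewrite ger0_norm// ltW.
  apply: measurable_funTS; apply: (measurableT_comp mf).
  apply: measurable_fun_pair; first exact: measurable_cst.
  have ma : measurable_fun setT ((fun u => a * u)%R : T -> T) := @mulrl_measurable _ _ _.
  exact: ma.
rewrite integral_itv_obnd_cbnd; last first.
  by apply: measurable_funTS; apply: (@measurable_section_integral _ _ _ _ (fun z : T * T => `|z.1|%:E * f (z.1, z.1 * z.2)%R)) => // x; rewrite mule_ge0.
rewrite (@tonelli_setX _ `[0%R, +oo[ `[0%R, +oo[ (fun z : T * T => `|z.1|%:E * f (z.1, z.1 * z.2)%R))//; last first.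
  by move=> x; rewrite mule_ge0.
transitivity (\int[mu]_(u in `[0%R, +oo[) ((oneDsqr u)^-1%:E * \int[mu]_(t in `[0%R, +oo[) tf t)).
  apply: eq_integral => u _ /=.
  have c0 : (0 < Num.sqrt (oneDsqr u))%R by rewrite sqrtr_gt0 (lt_le_trans ltr01).
  have c2 : (Num.sqrt (oneDsqr u) * Num.sqrt (oneDsqr u) = oneDsqr u)%R.
    by rewrite -expr2 sqr_sqrtr// (le_trans ler01).
  set c := Num.sqrt (oneDsqr u) in c0 c2 *.
  rewrite [in RHS](@ge0_integral_scale _ c)//.
  have -> : \int[mu]_(x in `[0%R, +oo[) tf (c * x)%R =
      c%:E * \int[mu]_(x in `[0%R, +oo[) (`|x|%:E * f (x, x * u)%R).
    rewrite -ge0_integralZl//.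
    - apply: eq_integral => x _; rewrite /tf normrM (gtr0_norm c0) EFinM -muleA.
      congr (_ * (_ * _)); apply: fr; rewrite /enorm2/= expr0n addr0.
      by rewrite !exprMn expr2 c2 /oneDsqr; congr Num.sqrt; ring.
    - apply: measurable_funTS; exact: (measurableT_comp mg (pair2_measurable u)).
    - by move=> x _; rewrite mule_ge0.
    - by rewrite lee_fin ltW.
  by rewrite !muleA -!EFinM -mulrA c2 mulVf ?mul1e//.
have tfi : 0 <= \int[mu]_(t in `[0%R, +oo[) tf t by apply: integral_ge0 => t _; exact: tf0.
rewrite ge0_integralZr//.
- rewrite integral0y_oneDsqr; congr (_ * _).
  by apply: eq_integral => t; rewrite inE/= in_itv/= andbT /tf => /ger0_norm->.
- apply: measurable_funTS; apply/measurable_EFinP.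
  by apply: continuous_measurable_fun; exact: continuous_oneDsqrV.
Qed.
End polar.

(** * The tail of an inverse square *)

Lemma is_derive_inv_shift {R : realType} (r x : R) : r + x != 0 ->
  is_derive x 1 (fun b : R => (r + b)^-1) (- (r + x) ^- 2).
Proof.
move=> rx.
have d1 : is_derive x 1 (fun b : R => r + b) 1.
  rewrite (_ : (fun b => _) = shift r); first exact: is_derive_shift.
  by apply/funext => b /=; rewrite addrC.
apply: DeriveDef; first exact: derivableV.
by rewrite deriveV// derive_val scaler1.
Qed.

Lemma continuous_inv_sqr {R : realType} (r x : R) : r + x != 0 ->
  {for x, continuous (fun b : R => r ^+ 2 / (r + b) ^+ 2)}.
Proof.
move=> rx; apply: cvgM; first exact: cvg_cst.
apply: cvgV; first by rewrite expf_neq0.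
apply: (@cvg_comp _ _ _ (fun b : R => r + b) (fun y => y ^+ 2)); last exact: exprn_continuous.
by apply: cvgD; [exact: cvg_cst|exact: cvg_id].
Qed.

(** The antiderivative [- r ^+ 2 / (r + b)] vanishes at infinity. The integrand is
    [(1 + b / r) ^- 2], the one-coordinate majorant of a connection function with range [r]. *)
Lemma integral_inv_sqr {R : realType} (r c : R) : 0 < r -> 0 <= c ->
  (\int[@lebesgue_measure R]_(b in `[c, +oo[) (r ^+ 2 / (r + b) ^+ 2)%:E = (r ^+ 2 / (r + c))%:E)%E.
Proof.
move=> r0 c0.
pose F := fun b : R => - r ^+ 2 * (r + b)^-1.
have rx (x : R) : c <= x -> r + x != 0 by move=> cx; rewrite gt_eqF//; lra.
have dF (x : R) : c <= x -> is_derive x 1 F (r ^+ 2 / (r + x) ^+ 2).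
  move=> cx; have := is_derive_inv_shift (rx _ cx) => dx.
  rewrite (_ : _ / _ = - r ^+ 2 *: (- (r + x) ^- 2)); last by rewrite scalerN scaleNr opprK.
  exact: is_deriveZ.
have cF (x : R) : c <= x -> {for x, continuous F}.
  by move=> /dF dx; apply: differentiable_continuous; exact/derivable1_diffP.
rewrite (@ge0_continuous_FTC2y _ _ F c 0)/=.
- by rewrite /F -EFinB sub0r mulNr opprK.
- by move=> x xc; rewrite divr_ge0 ?sqr_ge0.
- apply/continuous_within_itvcyP; split.
    by move=> x; rewrite in_itv/= andbT => /ltW/rx; exact: continuous_inv_sqr.
  by apply/cvg_at_right_filter/continuous_inv_sqr/rx.
- rewrite -(mulr0 (- r ^+ 2)); apply: cvgM; first exact: cvg_cst.
  apply/gtr0_cvgV0.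
    by near=> x; rewrite addr_gt0//; near: x; apply: nbhs_pinfty_gt; rewrite num_real.
  apply/cvgryPge => A; near=> x.
  apply: (@le_trans _ _ x); last by rewrite lerDr ltW.
  by near: x; apply: nbhs_pinfty_ge; rewrite num_real.
- by move=> x /ltW/dF ?; exact: ex_derive.
- exact/cvg_at_right_filter/cF.
- move=> x; rewrite in_itv/= andbT => /ltW/dF ?; rewrite derive1E.
  exact: derive_val.
Unshelve. all: by end_near. Qed.

(** * Masses of boxes and strips in the positive quadrant *)

Section quadrant.
Context {R : realType}.
Let mu := @lebesgue_measure R.
Let T := measurableTypeR R.
Local Open Scope ereal_scope.
Variable f : R * R -> R.

(* Locked: unifying two unfolded iterated integrals is prohibitively slow. *)
Definition quad_integral : set R -> set R -> \bar R :=
  locked (fun A B => \int[mu]_(a in A) \int[mu]_(b in B) (f (a, b))%:E).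

Lemma quad_integralE A B :
  quad_integral A B = \int[mu]_(a in A) \int[mu]_(b in B) (f (a, b))%:E.
Proof. by rewrite /quad_integral -lock. Qed.

Hypothesis mf : measurable_fun [set: R * R] f.
Hypothesis f_ge0 : forall x, (0 <= f x)%R.
Hypothesis f_mono : forall x y, (enorm2 x <= enorm2 y -> f y <= f x)%R.

Let fE : T * T -> \bar R := fun z => (f z)%:E.

Let mfE : measurable_fun setT fE.
Proof. exact/measurable_EFinP. Qed.

Let fE_ge0 z : 0 <= fE z.
Proof. by rewrite lee_fin. Qed.

Let f_radial x y : enorm2 x = enorm2 y -> f x = f y.
Proof.
by move=> xy; apply/eqP; rewrite eq_le !f_mono// xy.
Qed.

Let f_swap a b : f (a, b) = f (b, a).
Proof. by apply: f_radial; rewrite /enorm2/= addrC. Qed.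

Let f_opp1 a b : f (- a, b)%R = f (a, b).
Proof. by apply: f_radial; rewrite /enorm2/= sqrrN. Qed.

Let f_opp2 a b : f (a, - b)%R = f (a, b).
Proof. by apply: f_radial; rewrite /enorm2/= sqrrN. Qed.

Let msec a : measurable_fun setT (fun b : T => fE (a, b)).
Proof. exact: (measurableT_comp mfE (pair1_measurable a)). Qed.

Let mint (B : set R) : measurable B ->
  measurable_fun setT (fun a : T => \int[mu]_(b in B) (f (a, b))%:E).
Proof. by move=> mB; exact: (@measurable_section_integral _ _ _ _ fE). Qed.

Let msecS (D : set R) a : measurable_fun D (fun b : T => fE (a, b)).
Proof. by apply: measurable_funTS; exact: msec. Qed.

Let mintS (D B : set R) : measurable B ->
  measurable_fun D (fun a : T => \int[mu]_(b in B) (f (a, b))%:E).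
Proof. by move=> mB; apply: measurable_funTS; exact: mint. Qed.

Let int_ge0 (B : set R) a : 0 <= \int[mu]_(b in B) (f (a, b))%:E.
Proof. by apply: integral_ge0 => b _; exact: fE_ge0. Qed.

Lemma quad_integral_ge0 A B : 0 <= quad_integral A B.
Proof. by rewrite quad_integralE; apply: integral_ge0 => a _; exact: int_ge0. Qed.

Lemma quad_integralC A B : measurable A -> measurable B ->
  quad_integral A B = quad_integral B A.
Proof.
move=> mA mB; rewrite !quad_integralE (tonelli_setX mA mB mfE fE_ge0).
by apply: eq_integral => a _; apply: eq_integral => b _; rewrite /fE f_swap.
Qed.

Lemma le_quad_integral A A' B B' : measurable A -> measurable A' ->
  measurable B -> measurable B' -> A `<=` A' -> B `<=` B' ->
  quad_integral A B <= quad_integral A' B'.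
Proof.
move=> mA mA' mB mB' AA' BB'.
apply: (@le_trans _ _ (quad_integral A' B)).
  by rewrite !quad_integralE; apply: ge0_subset_integral => //; exact: mintS.
rewrite !quad_integralE; apply: ge0_le_integral => //.
- exact: mintS.
- exact: mintS.
- move=> a _; apply: ge0_subset_integral => //; first exact: msecS.
  by move=> b _; exact: fE_ge0.
Qed.

Lemma integral_quadT : \int[leb2 R]_x (f x)%:E =
  4%:E * quad_integral `[0%R, +oo[ `[0%R, +oo[.
Proof.
rewrite -setXTT (integral_setX (f := fE))//.
rewrite ge0_integral_evenT; first last.
- by move=> a; apply: eq_integral => b _; rewrite /fE f_opp1.
- by move=> a; exact: int_ge0.
- exact: mint.
have -> : \int[mu]_(a in `[0%R, +oo[) (\int[mu]_y fE (a, y)) =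
   quad_integral `[0%R, +oo[ `[0%R, +oo[ + quad_integral `[0%R, +oo[ `[0%R, +oo[.
  rewrite quad_integralE -ge0_integralD//; [|by apply: measurable_funTS; exact: mint..].
  apply: eq_integral => a _; rewrite (@ge0_integral_evenT _ (fun b => fE (a, b)))//.
  by move=> b; rewrite /fE /= f_opp2.
set q := quad_integral _ _.
have q0 : 0 <= q by exact: quad_integral_ge0.
rewrite (_ : 4%R = 1 + 1 + (1 + 1))%R; last by ring.
by rewrite !EFinD !ge0_muleDl ?adde_ge0// mul1e.
Qed.

Let quad_even (A : set R) (u v : R) : measurable A -> (0 <= u)%R -> (0 <= v)%R ->
  quad_integral `[(- u)%R, v] A = quad_integral `[0%R, u] A + quad_integral `[0%R, v] A.
Proof.
move=> mA u0 v0; rewrite !quad_integralE; apply: ge0_integral_even_itv => //; first exact: mint.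
by move=> a; apply: eq_integral => b _; rewrite f_opp1.
Qed.

Let quad_shift (x1 x2 : R) :
  \int[leb2 R]_(y in @unit_square R) (f (y - (x1, x2)))%:E =
  quad_integral `[(- x1)%R, (1 - x1)%R] `[(- x2)%R, (1 - x2)%R].
Proof.
have Ix (x : R) : (fun y : R => y - x)%R @^-1` `[(- x)%R, (1 - x)%R] = `[0%R, 1%R]%classic.
  by apply/seteqP; split => y /=; rewrite !in_itv/= => /andP[? ?]; apply/andP; split; lra.
rewrite /unit_square (integral_setX (f := fun z => fE (z - (x1, x2))%R))//; last first.
  apply: (measurableT_comp mfE); apply: measurable_fun_pair; apply: measurable_funB => //.
rewrite quad_integralE [RHS](@ge0_integral_shift _ _ (- x1)%R)//; last exact: mint.
rewrite Ix; apply: eq_integral => a _.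
by rewrite [RHS](@ge0_integral_shift _ _ (- x2)%R)//; [rewrite Ix|exact: msec|by move=> b; exact: fE_ge0].
Qed.

(** The axes cut the square translated by [- x] into four boxes with a corner at the origin, and
    evenness in each coordinate folds them into the positive quadrant. *)
Lemma integral_quad_window (x1 x2 : R) : (0 <= x1 <= 1)%R -> (0 <= x2 <= 1)%R ->
  \int[leb2 R]_(y in @unit_square R) (f (y - (x1, x2)))%:E =
  quad_integral `[0%R, x1] `[0%R, x2] + quad_integral `[0%R, (1 - x1)%R] `[0%R, x2] +
  (quad_integral `[0%R, x1] `[0%R, (1 - x2)%R] + quad_integral `[0%R, (1 - x1)%R] `[0%R, (1 - x2)%R]).
Proof.
move=> /andP[x10 x11] /andP[x20 x21]; rewrite quad_shift.
have V2 A : measurable A -> quad_integral A `[(- x2)%R, (1 - x2)%R] =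
    quad_integral A `[0%R, x2] + quad_integral A `[0%R, (1 - x2)%R].
  move=> mA; rewrite (quad_integralC mA (measurable_itv _)) quad_even ?subr_ge0//.
  by congr (_ + _); apply: quad_integralC; rewrite //; exact: measurable_itv.
rewrite (quad_even (measurable_itv _)) ?subr_ge0//.
rewrite (V2 _ (measurable_itv `[0%R, x1])) (V2 _ (measurable_itv `[0%R, (1 - x1)%R])).
exact: addeACA.
Qed.

Variable p : R.
Hypothesis f_le : forall x, (f x <= p)%R.

Let p_ge0 : (0 <= p)%R.
Proof. by rewrite (le_trans (f_ge0 0%R)). Qed.

Let H := \int[mu]_(b in `[0%R, +oo[) (f (0, b)%R)%:E.

(** Moving away from the axis lowers [f], so no slice at [a] carries more than the axis mass [H]. *)
Lemma quad_integral_le_strip (u : R) (B : set R) : (0 <= u)%R -> measurable B ->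
  B `<=` `[0%R, +oo[ -> quad_integral `[0%R, u] B <= u%:E * H.
Proof.
move=> u0 mB BS; rewrite quad_integralE.
have H0 : 0 <= H by exact: int_ge0.
apply: (@le_trans _ _ (\int[mu]_(a in `[0%R, u]) cst H a)).
  apply: ge0_le_integral => //.
  - exact: mintS.
  - move=> a _; apply: (@le_trans _ _ (\int[mu]_(b in `[0%R, +oo[) (f (a, b))%:E)).
      apply: ge0_subset_integral => //; first exact: msecS.
      by move=> b _; exact: fE_ge0.
    apply: ge0_le_integral => //; try exact: msecS; try by move=> b _; exact: fE_ge0.
    + move=> b _; rewrite lee_fin f_mono// /enorm2/= ler_wsqrtr//.
      by rewrite expr0n add0r lerDr sqr_ge0.
rewrite integral_cst// muleC.
rewrite [X in X * _](_ : _ = u%:E)//.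
rewrite [LHS]lebesgue_measure_itv/= lte_fin.
by case: ltP => u0'; [rewrite oppr0 adde0|congr (_%:E); lra].
Qed.

Let section_split (c : T) (a : R) : (0 <= a)%R ->
  \int[mu]_(b in `[0%R, +oo[) (f (c, b))%:E =
  \int[mu]_(b in `[0%R, a]) (f (c, b))%:E + \int[mu]_(b in `]a, +oo[) (f (c, b))%:E.
Proof.
move=> a0.
have -> : `[0%R, +oo[%classic = `[0%R, a]%classic `|` `]a, +oo[%classic :> set R.
  apply/seteqP; split => x /=; rewrite !in_itv/= !andbT.
    by move=> x0; case: (leP x a) => ?; [left; apply/andP|right].
  by case=> [/andP[]//|]; lra.
apply: ge0_integral_setU => //; [exact: msecS|by move=> x _; exact: fE_ge0|].
by apply/disj_setPS => x /= []; rewrite !in_itv/= => /andP[? ?] /andP[? ?]; lra.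
Qed.

Let section_shift_measurable (D : set R) (c : T) (a : R) :
  measurable_fun D (fun b : T => (f (c, b + a)%R)%:E).
Proof.
apply: measurable_funTS; apply: (measurableT_comp mfE).
by apply: measurable_fun_pair => //; exact: measurable_funD.
Qed.

Let section_shift (c : T) (a : R) :
  \int[mu]_(b in `]a, +oo[) (f (c, b))%:E <=
  \int[mu]_(b in `[0%R, +oo[) (f (c, b + a)%R)%:E.
Proof.
rewrite (ge0_integral_shift a (measurable_itv _) (msec c) (fun b => fE_ge0 _)).
have ma : measurable_fun setT ((fun b => b + a)%R : T -> T) by exact: measurable_funD.
apply: ge0_subset_integral.
- by rewrite -[X in measurable X]setTI; apply: ma => //; exact: measurable_itv.
- exact: measurable_itv.
- exact: section_shift_measurable.
- by move=> b _; exact: fE_ge0.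
- by move=> x; rewrite /= !in_itv/= !andbT; lra.
Qed.

(** The norm of (a, b) is at most a + b, so the slice at [a] carries at least the axis mass beyond
    [a]. The axis loses at most [a * p <= u * p] on [0, a], and integrating over [0, u] turns this
    into [u * u * p]. *)
Lemma quad_integral_ge_strip (u : R) : (0 <= u)%R ->
  u%:E * H <= quad_integral `[0%R, u] `[0%R, +oo[ + (u * u * p)%:E.
Proof.
move=> u0.
have H0 : 0 <= H by exact: int_ge0.
have mI : measurable (`[0%R, u]%classic : set R) by [].
have lI : mu `[0%R, u] = u%:E.
  rewrite [mu _]lebesgue_measure_itv/= lte_fin.
  by case: ltP => [_|u0']; [rewrite oppr0 adde0|congr (_%:E); lra].
have -> : u%:E * H = \int[mu]_(a in `[0%R, u]) cst H a.
  by rewrite integral_cst// muleC; congr (_ * _); exact/esym.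
have -> : (u * u * p)%:E = \int[mu]_(a in `[0%R, u]) cst (u * p)%:E a.
  by rewrite integral_cst// [X in _ * X]lI -EFinM; congr (_%:E); ring.
have up0 : 0 <= (u * p)%:E by rewrite lee_fin mulr_ge0.
rewrite quad_integralE -ge0_integralD//; last exact: mintS.
apply: ge0_le_integral => //; first by apply: emeasurable_funD => //; exact: mintS.
move=> a; rewrite /= in_itv/= => /andP[a0 au].
rewrite /H (section_split 0%R a0) addeC leeD//.
  apply: (le_trans (section_shift _ _)).
  apply: ge0_le_integral => //; try exact: section_shift_measurable;
    try exact: msecS; try by move=> b _; exact: fE_ge0.
  - move=> b; rewrite /= in_itv/= andbT => b0; rewrite lee_fin f_mono// /enorm2/=.
    rewrite ler_wsqrtr// expr0n add0r sqrrD.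
    have : (0 <= b * a)%R by exact: mulr_ge0.
    by rewrite mulr2n; lra.
apply: (@le_trans _ _ (\int[mu]_(b in `[0%R, a]) cst p%:E b)).
  apply: ge0_le_integral => //; try exact: msecS; try by move=> b _; exact: fE_ge0.
  by move=> b _; rewrite /cst lee_fin f_le.
rewrite integral_cst// [X in _ * X]lebesgue_measure_itv/= lte_fin.
case: ltP => a0'; last by rewrite mule0.
by rewrite oppr0 adde0 -EFinM lee_fin mulrC ler_wpM2r.
Qed.

Variables (K r : R).
Hypothesis r_gt0 : (0 < r)%R.
Hypothesis K_ge0 : (0 <= K)%R.
Hypothesis f_decay : forall a b : R, (0 <= a)%R -> (0 <= b)%R ->
  (f (a, b) <= K * (r ^+ 2 / (r + a) ^+ 2) * (r ^+ 2 / (r + b) ^+ 2))%R.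

(** The majorant in [f_decay] is a product, so the variables separate: the integral over b gives
    [r ^+ 2 / (r + c)] and the one over a gives [r]. *)
Lemma quad_integral_tail (c : R) : (0 <= c)%R ->
  quad_integral `[0%R, +oo[ `[c, +oo[ <= (K * r * (r ^+ 2 / (r + c)))%:E.
Proof.
move=> c0; rewrite quad_integralE.
pose g := fun x : T => (r ^+ 2 / (r + x) ^+ 2)%:E.
have g0 x : 0 <= g x by rewrite lee_fin divr_ge0 ?sqr_ge0.
have mgS (e : R) : (0 <= e)%R -> measurable_fun `[e, +oo[ g.
  move=> e0; have : {within `[e, +oo[, continuous (fun x : R => r ^+ 2 / (r + x) ^+ 2)%R}.
    apply: continuous_in_subspaceT => x; rewrite inE/= in_itv/= andbT => ex.
    by apply: continuous_inv_sqr; rewrite gt_eqF// (lt_le_trans r_gt0)// lerDl (le_trans e0).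
  by move/(subspace_continuous_measurable_fun (measurable_itv _))/measurable_EFinP.
have /mgS mg0 : (0 <= 0 :> R)%R by [].
have mgc := mgS _ c0.
have C0 : 0 <= (r ^+ 2 / (r + c))%:E by rewrite lee_fin divr_ge0 ?sqr_ge0 ?addr_ge0// ltW.
have KC0 : 0 <= K%:E * (r ^+ 2 / (r + c))%:E by rewrite mule_ge0.
apply: (@le_trans _ _ (\int[mu]_(a in `[0%R, +oo[) (K%:E * (r ^+ 2 / (r + c))%:E * g a))).
  apply: ge0_le_integral; [by []|by []|exact: mintS|
    exact: measurable_funeM|].
  move=> a; rewrite /= in_itv/= andbT => a0.
  have -> : K%:E * (r ^+ 2 / (r + c))%:E * g a = (K%:E * g a) * \int[mu]_(b in `[c, +oo[) g b.
    by rewrite /g integral_inv_sqr// -!EFinM mulrAC.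
  have Kg : 0 <= K%:E * g a by rewrite mule_ge0.
  rewrite -[X in _ <= X](ge0_integralZl mu (measurable_itv _) mgc)//.
  apply: ge0_le_integral; [by []|by move=> b _; exact: fE_ge0|exact: msecS|
    exact: measurable_funeM|].
  move=> b; rewrite /= in_itv/= andbT => cb.
  by rewrite /g -!EFinM lee_fin f_decay// (le_trans c0).
rewrite [X in X <= _](ge0_integralZl mu (measurable_itv _) mg0)// /g integral_inv_sqr// addr0 -!EFinM lee_fin.
rewrite (_ : r ^+ 2 / r = r)%R; last by rewrite expr2 mulfK// gt_eqF.
by rewrite mulrAC.
Qed.

Let mI (u : itv_bound R) (v : itv_bound R) : measurable ([set` Interval u v] : set R).
Proof. exact: measurable_itv. Qed.

Let split_tail (A : set R) (c v : R) : measurable A -> A `<=` `[0%R, +oo[ ->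
  (0 <= c)%R -> (c <= v)%R ->
  quad_integral A `[0%R, +oo[ <= quad_integral A `[0%R, v] + (K * r * (r ^+ 2 / (r + c)))%:E.
Proof.
move=> mA sA c0 cv.
have v0 : (0 <= v)%R by exact: le_trans cv.
apply: (@le_trans _ _ (quad_integral A `[0%R, v] + quad_integral A `]v, +oo[)).
  rewrite !quad_integralE le_eqVlt; apply/orP; left; apply/eqP.
  transitivity (\int[mu]_(a in A) (\int[mu]_(b in `[0%R, v]) (f (a, b))%:E +
      \int[mu]_(b in `]v, +oo[) (f (a, b))%:E)).
    by apply: eq_integral => a _; exact: section_split.
  apply: ge0_integralD => //; try exact: mintS; by move=> a _; exact: int_ge0.
rewrite leeD2l//; apply: le_trans (quad_integral_tail c0).
apply: le_quad_integral => // x; rewrite /= !in_itv/= !andbT => /ltW.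
exact: le_trans.
Qed.

Let quad_fin (A B : set R) : measurable A -> measurable B ->
  A `<=` `[0%R, +oo[ -> B `<=` `[0%R, +oo[ -> quad_integral A B \is a fin_num.
Proof.
move=> mA mB sA sB; rewrite ge0_fin_numE; last exact: quad_integral_ge0.
have := le_quad_integral mA (mI _ _) mB (mI _ _) sA sB => /le_lt_trans; apply.
by rewrite (le_lt_trans (quad_integral_tail (lexx 0%R)))// ltry.
Qed.

Let sub0u (u : R) : `[0%R, u]%classic `<=` `[0%R, +oo[%classic.
Proof. by move=> x; rewrite /= !in_itv/= andbT => /andP[]. Qed.

Let quad_fin_box (u v : R) : quad_integral `[0%R, u] `[0%R, v] \is a fin_num.
Proof. by apply: quad_fin => //; exact: sub0u. Qed.

Definition box_integral (u v : R) : R := fine (quad_integral `[0%R, u] `[0%R, v]).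

Let I4 : R := fine (quad_integral `[0%R, +oo[ `[0%R, +oo[).

Let Hr : R := fine H.

Lemma axis_integral_fin : H \is a fin_num.
Proof.
rewrite ge0_fin_numE; last exact: int_ge0.
have := quad_integral_ge_strip ler01; rewrite mul1e => /le_lt_trans; apply.
have : quad_integral `[0%R, 1%R] `[0%R, +oo[ \is a fin_num by apply: quad_fin => //; exact: sub0u.
by move/fineK <-; rewrite -EFinD ltry.
Qed.

Lemma conn_integral_quad : conn_integral f = (4 * I4)%R.
Proof.
rewrite /conn_integral /Rintegral integral_quadT.
by rewrite fineM// ?quad_fin.
Qed.

Lemma window_box_integral (x1 x2 : R) : (0 <= x1 <= 1)%R -> (0 <= x2 <= 1)%R ->
  (\int[leb2 R]_(y in @unit_square R) f (y - (x1, x2)) =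
  box_integral x1 x2 + box_integral (1 - x1) x2 +
  (box_integral x1 (1 - x2) + box_integral (1 - x1) (1 - x2)))%R.
Proof.
move=> x1P x2P; rewrite /Rintegral integral_quad_window//.
have E (a b c d : \bar R) : a \is a fin_num -> b \is a fin_num -> c \is a fin_num ->
    d \is a fin_num -> fine (a + b + (c + d)) = (fine a + fine b + (fine c + fine d))%R.
  by move=> ? ? ? ?; rewrite !fineD// fin_numD; apply/andP.
by apply: E; exact: quad_fin_box.
Qed.

Lemma box_integral_ge0 (u v : R) : (0 <= box_integral u v)%R.
Proof. by rewrite fine_ge0// quad_integral_ge0. Qed.

Lemma box_integralC (u v : R) : box_integral u v = box_integral v u.
Proof. by rewrite /box_integral quad_integralC. Qed.

Lemma box_integral_le (u v : R) : (box_integral u v <= I4)%R.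
Proof.
apply: fine_le; [exact: quad_fin_box|exact: quad_fin|].
by apply: le_quad_integral => //; exact: sub0u.
Qed.

Lemma box_integral_le_strip (u v : R) : (0 <= u)%R -> (box_integral u v <= u * Hr)%R.
Proof.
move=> u0; rewrite -lee_fin fineK ?quad_fin_box// EFinM (fineK axis_integral_fin).
by apply: quad_integral_le_strip => //; exact: sub0u.
Qed.

(** The widths [u] and [u'] are kept apart because the quadratic loss [u * u * p] is affordable only
    for small [u]; a wider box is estimated by its first strip alone. *)
Lemma box_integral_ge_strip (u u' c v : R) : (0 <= u)%R -> (u <= u')%R ->
  (0 <= c)%R -> (c <= v)%R ->
  (u * Hr - u * u * p - K * r * (r ^+ 2 / (r + c)) <= box_integral u' v)%R.
Proof.
move=> u0 uu' c0 cv.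
have h1 := quad_integral_ge_strip u0.
have h2 := split_tail (mI _ _) (@sub0u u) c0 cv.
have h3 : quad_integral `[0%R, u] `[0%R, v] <= quad_integral `[0%R, u'] `[0%R, v].
  apply: le_quad_integral => // x; rewrite /= !in_itv/= => /andP[-> xu].
  exact: le_trans uu'.
move: h1 h2 h3; rewrite -(fineK (quad_fin_box u v)) -(fineK (quad_fin_box u' v)).
rewrite -(fineK axis_integral_fin) -/(box_integral u' v) -/Hr.
have qf : quad_integral `[0%R, u] `[0%R, +oo[ \is a fin_num by apply: quad_fin => //; exact: sub0u.
rewrite -(fineK qf) -EFinM -!EFinD !lee_fin; lra.
Qed.

(** A comparison of the axis mass with the quadrant mass at a free width [u]. Suitable widths turn
    it into an upper bound for [J1] and a lower bound for [J2]. *)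
Lemma quad_fine_ge_strip (u : R) : (0 <= u)%R -> (u * Hr - u * u * p <= I4)%R.
Proof.
move=> u0; have := quad_integral_ge_strip u0.
have : quad_integral `[0%R, u] `[0%R, +oo[ <= quad_integral `[0%R, +oo[ `[0%R, +oo[.
  by apply: le_quad_integral => //; exact: sub0u.
have qf : quad_integral `[0%R, u] `[0%R, +oo[ \is a fin_num by apply: quad_fin => //; exact: sub0u.
have q4 : quad_integral `[0%R, +oo[ `[0%R, +oo[ \is a fin_num by exact: quad_fin.
by rewrite -(fineK qf) -(fineK q4) -(fineK axis_integral_fin) -EFinM -EFinD !lee_fin -/I4 -/Hr; lra.
Qed.

Lemma quad_fine_le : (I4 <= K * r ^+ 2)%R.
Proof.
have q4 : quad_integral `[0%R, +oo[ `[0%R, +oo[ \is a fin_num by exact: quad_fin.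
have := quad_integral_tail (lexx 0%R); rewrite -(fineK q4) lee_fin -/I4 addr0.
by rewrite [(r ^+ 2 / r)%R](_ : _ = r) ?expr2 ?mulfK ?gt_eqF// mulrA.
Qed.

(** The quadrant outside the box is covered by one tail in each coordinate. Exchanging the
    coordinates makes both of the same kind, hence the factor 2. *)
Lemma box_integral_ge_tail (u c v : R) : (0 <= c)%R -> (c <= u)%R -> (c <= v)%R ->
  (I4 - 2 * (K * r * (r ^+ 2 / (r + c))) <= box_integral u v)%R.
Proof.
move=> c0 cu cv.
have h1 := split_tail (mI _ _) (@subset_refl _ `[0%R, +oo[%classic) c0 cv.
have h2 := split_tail (mI _ _) (@sub0u v) c0 cu.
move: h1 h2; rewrite (@quad_integralC `[0%R, +oo[ `[0%R, v])//.
rewrite (@quad_integralC `[0%R, v] `[0%R, u])//.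
have qf : quad_integral `[0%R, v] `[0%R, +oo[ \is a fin_num by apply: quad_fin => //; exact: sub0u.
have q4 : quad_integral `[0%R, +oo[ `[0%R, +oo[ \is a fin_num by exact: quad_fin.
rewrite -(fineK qf) -(fineK q4) -(fineK (quad_fin_box u v)) -!EFinD !lee_fin -/I4 -/(box_integral u v); lra.
Qed.

(** The shifted function is seen as a function of four real variables, the two of [x] being
    parameters; integrating out the other two one after the other preserves measurability. *)
Lemma measurable_window :
  measurable_fun setT (fun x : T * T => \int[leb2 R]_(y in @unit_square R) f (y - x))%R.
Proof.
have mfl : measurable_fun setT (fun z : (T * T) * T * T => fE (z.1.2 - z.1.1.1, z.2 - z.1.1.2)%R).
  apply: (measurableT_comp mfE); apply: measurable_fun_pair; apply: measurable_funB.
  - by apply: measurableT_comp; [exact: measurable_snd|exact: measurable_fst].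
  - apply: (measurableT_comp measurable_fst); apply: (measurableT_comp measurable_fst); exact: measurable_fst.
  - exact: measurable_snd.
  - apply: (measurableT_comp measurable_snd); apply: (measurableT_comp measurable_fst); exact: measurable_fst.
have mI01 : measurable (`[0%R, 1%R]%classic : set R) by exact: mI.
have m1 := measurable_section_integral mI01 mfl (fun _ => fE_ge0 _).
have m2 := measurable_section_integral mI01 m1 (fun z => integral_ge0 _ (fun y _ => fE_ge0 _)).
rewrite (_ : (fun x => _) = fine \o (fun x : T * T =>
   \int[mu]_(y1 in `[0%R, 1%R]) \int[mu]_(y2 in `[0%R, 1%R]) fE (y1 - x.1, y2 - x.2)%R)).
  apply: measurableT_comp m2; exact: fine_measurable.
apply/funext => x; rewrite /Rintegral/=; congr fine.
rewrite /unit_square (integral_setX (f := fun z => fE (z - x)%R))//.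
apply: (measurableT_comp mfE); apply: measurable_fun_pair; apply: measurable_funB => //.
Qed.

End quadrant.

(** * Product functions on the square with known integrals *)

Section exp_edges.
Context {R : realType}.
Let mu := @lebesgue_measure R.

Definition edge_exp (k t : R) : R := expR (- (k * t)) + expR (- (k * (1 - t))).

Definition edge_mass (k : R) : R := 2 * (1 - expR (- k)) / k.

Lemma edge_exp_ge0 k t : 0 <= edge_exp k t.
Proof. by rewrite addr_ge0// expR_ge0. Qed.

Lemma edge_exp_sym k t : edge_exp k (1 - t) = edge_exp k t.
Proof. by rewrite /edge_exp subKr addrC. Qed.

Lemma continuous_expRM (k m : R) : continuous (fun t : R => expR (k * t + m)).
Proof.
move=> x; apply: (@cvg_comp _ _ _ (fun t : R => k * t + m) expR); last exact: continuous_expR.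
by apply: cvgD; [apply: cvgM; [exact: cvg_cst|exact: cvg_id]|exact: cvg_cst].
Qed.

Lemma continuous_edge_exp k : continuous (edge_exp k).
Proof.
rewrite (_ : edge_exp k = fun t => expR (- k * t + 0) + expR (k * t + - k)).
  by move=> x; apply: cvgD; exact: continuous_expRM.
by apply/funext => t; congr (expR _ + expR _); ring.
Qed.

Lemma is_derive_expRM (k m x : R) : is_derive x 1 (fun t : R => expR (k * t + m)) (k * expR (k * x + m)).
Proof.
have d1 : is_derive x 1 (fun t : R => k * t + m) k.
  have := @is_deriveD _ _ _ (k \*: (@id R)) (cst m) x 1 _ _
    (is_deriveZ k (is_derive_id x 1)) (is_derive_cst m x 1).
  by rewrite addr0 [k *: _]mulr1.
have := @is_derive1_comp _ expR (fun t => k * t + m) x _ _ (is_derive_expR _) d1.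
by rewrite mulrC.
Qed.

Lemma integral_edge_exp (k : R) : 0 < k ->
  (\int[mu]_(t in `[0%R, 1%R]) (edge_exp k t)%:E = (edge_mass k)%:E)%E.
Proof.
move=> k0.
pose F := fun t : R => k^-1 * (expR (k * t + - k) - expR (- k * t + 0)).
have dF (x : R) : is_derive x 1 F (edge_exp k x).
  have := is_deriveZ (k^-1) (is_deriveB (is_derive_expRM k (- k) x) (is_derive_expRM (- k) 0 x)).
  rewrite (_ : _ *: _ = edge_exp k x)//.
  rewrite /edge_exp [LHS]/GRing.scale/= mulNr opprK -mulrDr mulrA mulVf ?gt_eqF// mul1r addrC.
  by congr (expR _ + expR _); ring.
have cF : continuous F.
  by move=> x; apply: differentiable_continuous; apply/derivable1_diffP; have := dF x => ?; exact: ex_derive.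
rewrite (@continuous_FTC2 _ (edge_exp k) F 0 1)//.
- rewrite -EFinB /F; congr (_%:E).
  have -> : k * 1 + - k = 0 by ring.
  have -> : - k * 1 + 0 = - k by ring.
  have -> : k * 0 + - k = - k by ring.
  have -> : - k * 0 + 0 = 0 by ring.
  by rewrite expR0 /edge_mass; field; rewrite lt0r_neq0.
- exact/continuous_subspaceT/continuous_edge_exp.
- split.
  + by move=> x _; have := dF x => ?; exact: ex_derive.
  + exact/cvg_at_right_filter/cF.
  + exact/cvg_at_left_filter/cF.
- by move=> x _; rewrite derive1E; have := dF x => ?; exact: derive_val.
Qed.

Let T := measurableTypeR R.

(** The one-variable building blocks of both bounds on the outer integral. The bound 2 on [0, 1],
    natural for a sum of two exponentials at most 1, yields integrability of products, and [i]
    records the integral. *)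
Definition edge_factor (h : R -> R) (i : R) : Prop :=
  [/\ continuous h, forall x, 0 <= h x, forall x, 0 <= x <= 1 -> h x <= 2 &
   (\int[mu]_(t in `[0%R, 1%R]) (h t)%:E = i%:E)%E].

Lemma edge_factor1 : edge_factor (cst 1) 1.
Proof.
split.
- by move=> x; exact: cvg_cst.
- by move=> x; exact: ler01.
- by move=> x _; rewrite /cst; lra.
- transitivity (\int[mu]_(t in `[0%R, 1%R]) (cst 1%E t))%E; first exact: eq_integral.
  by rewrite integral_cst//= mul1e [LHS]lebesgue_measure_itv/= lte_fin ltr01 oppr0 adde0.
Qed.

Lemma edge_factor_exp k : 0 < k -> edge_factor (edge_exp k) (edge_mass k).
Proof.
move=> k0; split.
- exact: continuous_edge_exp.
- exact: edge_exp_ge0.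
- move=> x /andP[x0 x1]; have h y : 0 <= y -> expR (- (k * y)) <= 1.
    by move=> y0; rewrite expR_le1 oppr_le0 mulr_ge0// ltW.
  have := h _ x0; have : 0 <= 1 - x by rewrite subr_ge0.
  by move=> /h; rewrite /edge_exp; lra.
- exact: integral_edge_exp.
Qed.

Let measurable_square : measurable (@unit_square R : set (T * T)).
Proof. by apply: measurableX; exact: measurable_itv. Qed.

Let finite_square : (leb2 R (@unit_square R) < +oo)%E.
Proof.
rewrite [ltLHS]product_measure1E; [|exact: measurable_itv..].
rewrite [X in (X * _)%E]lebesgue_measure_itv [X in (_ * X)%E]lebesgue_measure_itv/= lte_fin ltr01.
by rewrite oppr0 adde0 mule1 ltry.
Qed.

(** Integrability is bundled with the value, so that the integral of a linear combination is
    obtained by composing the lemmas below along its syntax tree. *)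
Definition square_integral_eq (F : R * R -> R) (v : R) : Prop :=
  (leb2 R).-integrable (@unit_square R) (EFin \o F) /\
  \int[leb2 R]_(x in @unit_square R) F x = v.

Lemma square_bounded_integrable (F : R * R -> R) (M : R) :
  measurable_fun [set: T * T] F ->
  (forall x, @unit_square R x -> `|F x| <= M) ->
  (leb2 R).-integrable (@unit_square R) (EFin \o F).
Proof.
move=> mF FM; apply: measurable_bounded_integrable => //.
  exact: measurable_funTS.
exists M; split; first exact: num_real.
by move=> y My x xS; apply: le_trans (FM x xS) _; exact: ltW.
Qed.

Lemma square_integral_eq_prod h i k j : edge_factor h i -> edge_factor k j ->
  square_integral_eq (fun x => h x.1 * k x.2) (i * j).
Proof.
move=> [ch h0 h2 hi] [ck k0 k2 kj].
have mh : measurable_fun [set: T] h by exact: continuous_measurable_fun.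
have mk : measurable_fun [set: T] k by exact: continuous_measurable_fun.
have mhk : measurable_fun [set: T * T] (fun x : T * T => h x.1 * k x.2).
  by apply: measurable_funM; [exact: (measurableT_comp mh measurable_fst)|exact: (measurableT_comp mk measurable_snd)].
split.
  apply: (@square_bounded_integrable _ 4) => // x [/=]; rewrite !in_itv/= => x1 x2.
  rewrite ger0_norm ?mulr_ge0// (_ : 4 = 2 * 2); last by ring.
  by apply: ler_pM => //; [exact: h2|exact: k2].
rewrite /Rintegral (integral_setX (f := fun x => (h x.1 * k x.2)%:E))//=; last 2 first.
- exact/measurable_EFinP.
- by move=> x; rewrite lee_fin mulr_ge0.
rewrite (_ : (\int[mu]_(x in _) _ = \int[mu]_(x in `[0%R, 1%R]) ((h x)%:E * j%:E))%E); last first.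
  apply: eq_integral => x _; under eq_integral do rewrite EFinM.
  rewrite ge0_integralZl//; [by rewrite kj|exact/measurable_EFinP/measurable_funTS|..].
  - by move=> y _; rewrite lee_fin.
  - by rewrite lee_fin.
rewrite ge0_integralZr//; [by rewrite hi|exact/measurable_EFinP/measurable_funTS|..].
- by move=> x _; rewrite lee_fin.
- by rewrite -kj; apply: integral_ge0 => x _; rewrite lee_fin.
Qed.

Lemma square_integral_eqD F G u v : square_integral_eq F u -> square_integral_eq G v ->
  square_integral_eq (fun x => F x + G x) (u + v).
Proof.
move=> [iF <-] [iG <-]; split; last by rewrite RintegralD.
by apply: eq_integrable (integrableD _ iF iG) => //.
Qed.

Lemma square_integral_eqZ c F u : square_integral_eq F u ->
  square_integral_eq (fun x => c * F x) (c * u).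
Proof.
move=> [iF <-]; split; last by rewrite RintegralZl.
by apply: eq_integrable (integrableZl _ c iF) => //.
Qed.

Lemma square_integral_le F G u : square_integral_eq G u ->
  (leb2 R).-integrable (@unit_square R) (EFin \o F) ->
  (forall x, @unit_square R x -> F x <= G x) ->
  \int[leb2 R]_(x in @unit_square R) F x <= u.
Proof. by move=> [iG <-] iF FG; apply: le_Rintegral. Qed.

Lemma square_integral_ge F G u : square_integral_eq G u ->
  (leb2 R).-integrable (@unit_square R) (EFin \o F) ->
  (forall x, @unit_square R x -> G x <= F x) ->
  u <= \int[leb2 R]_(x in @unit_square R) F x.
Proof. by move=> [iG <-] iF FG; apply: le_Rintegral. Qed.

End exp_edges.

(** * Two-sided bounds on the outer integral *)

Section outer.
Context {R : realType}.
Let T := measurableTypeR R.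

(* A lower bound for a maximum by a polynomial; it lets the contributions of the
   interior and of the four sides be added without cutting the square up. *)
Lemma max_sqr_lower (z0 z1 z2 z3 z4 y : R) :
  0 <= z0 -> 0 <= z1 -> 0 <= z2 -> 0 <= z3 -> 0 <= z4 ->
  z0 ^+ 2 <= y -> z1 ^+ 2 <= y -> z2 ^+ 2 <= y -> z3 ^+ 2 <= y -> z4 ^+ 2 <= y ->
  z0 ^+ 2 + (z1 ^+ 2 + z2 ^+ 2 + (z3 ^+ 2 + z4 ^+ 2)) -
  (z0 * (z1 + z2 + (z3 + z4)) + (z1 * z2 + z3 * z4) + (z1 + z2) * (z3 + z4)) <= y.
Proof.
(* Here [a] is the largest of the five. Then [b ^+ 2 <= a * b] and its analogues cancel the other
   squares, and the remaining products are nonnegative and subtracted. The claim is symmetric in all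
   five variables, so it remains to find the maximum. *)
have aux (a b c d e : R) : 0 <= a -> 0 <= b -> 0 <= c -> 0 <= d -> 0 <= e ->
    b <= a -> c <= a -> d <= a -> e <= a -> a ^+ 2 <= y ->
    a ^+ 2 + b ^+ 2 + c ^+ 2 + d ^+ 2 + e ^+ 2 -
    (a * b + a * c + a * d + a * e + b * c + b * d + b * e + c * d + c * e + d * e) <= y.
  move=> a0 b0 c0 d0 e0 ba ca da ea ay.
  have hb := ler_wpM2r b0 ba; have hc := ler_wpM2r c0 ca.
  have hd := ler_wpM2r d0 da; have he := ler_wpM2r e0 ea.
  have := mulr_ge0 b0 c0; have := mulr_ge0 b0 d0; have := mulr_ge0 b0 e0.
  have := mulr_ge0 c0 d0; have := mulr_ge0 c0 e0; have := mulr_ge0 d0 e0.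
  by rewrite !expr2 in ay *; lra.
move=> p0 p1 p2 p3 p4 h0 h1 h2 h3 h4.
have A0 := aux z0 z1 z2 z3 z4 p0 p1 p2 p3 p4.
have A1 := aux z1 z0 z2 z3 z4 p1 p0 p2 p3 p4.
have A2 := aux z2 z0 z1 z3 z4 p2 p0 p1 p3 p4.
have A3 := aux z3 z0 z1 z2 z4 p3 p0 p1 p2 p4.
have A4 := aux z4 z0 z1 z2 z3 p4 p0 p1 p2 p3.
have fin0 : z1 <= z0 -> z2 <= z0 -> z3 <= z0 -> z4 <= z0 -> _ := fun a b c d => A0 a b c d h0.
have fin1 : z0 <= z1 -> z2 <= z1 -> z3 <= z1 -> z4 <= z1 -> _ := fun a b c d => A1 a b c d h1.
have fin2 : z0 <= z2 -> z1 <= z2 -> z3 <= z2 -> z4 <= z2 -> _ := fun a b c d => A2 a b c d h2.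
have fin3 : z0 <= z3 -> z1 <= z3 -> z2 <= z3 -> z4 <= z3 -> _ := fun a b c d => A3 a b c d h3.
have fin4 : z0 <= z4 -> z1 <= z4 -> z2 <= z4 -> z3 <= z4 -> _ := fun a b c d => A4 a b c d h4.
clear A0 A1 A2 A3 A4 aux.
have [m01|m01] := lerP z1 z0; have [m23|m23] := lerP z3 z2.
- have [m|m] := lerP z2 z0; [have [n|n] := lerP z4 z0|have [n|n] := lerP z4 z2].
  + have F := fin0 m01 m (le_trans m23 m) n; lra.
  + have F := fin4 (ltW n) (le_trans m01 (ltW n)) (le_trans m (ltW n)) (le_trans m23 (le_trans m (ltW n))); lra.
  + have F := fin2 (ltW m) (le_trans m01 (ltW m)) m23 n; lra.
  + have F := fin4 (ltW (lt_trans m n)) (le_trans m01 (ltW (lt_trans m n))) (ltW n) (le_trans m23 (ltW n)); lra.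
- have [m|m] := lerP z3 z0; [have [n|n] := lerP z4 z0|have [n|n] := lerP z4 z3].
  + have F := fin0 m01 (le_trans (ltW m23) m) m n; lra.
  + have F := fin4 (ltW n) (le_trans m01 (ltW n)) (le_trans (ltW m23) (le_trans m (ltW n))) (le_trans m (ltW n)); lra.
  + have F := fin3 (ltW m) (le_trans m01 (ltW m)) (ltW m23) n; lra.
  + have F := fin4 (ltW (lt_trans m n)) (le_trans m01 (ltW (lt_trans m n))) (ltW (lt_trans m23 n)) (ltW n); lra.
- have [m|m] := lerP z2 z1; [have [n|n] := lerP z4 z1|have [n|n] := lerP z4 z2].
  + have F := fin1 (ltW m01) m (le_trans m23 m) n; lra.
  + have F := fin4 (ltW (lt_trans m01 n)) (ltW n) (le_trans m (ltW n)) (le_trans m23 (le_trans m (ltW n))); lra.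
  + have F := fin2 (ltW (lt_trans m01 m)) (ltW m) m23 n; lra.
  + have F := fin4 (ltW (lt_trans m01 (lt_trans m n))) (ltW (lt_trans m n)) (ltW n) (le_trans m23 (ltW n)); lra.
- have [m|m] := lerP z3 z1; [have [n|n] := lerP z4 z1|have [n|n] := lerP z4 z3].
  + have F := fin1 (ltW m01) (le_trans (ltW m23) m) m n; lra.
  + have F := fin4 (ltW (lt_trans m01 n)) (ltW n) (le_trans (ltW m23) (le_trans m (ltW n))) (le_trans m (ltW n)); lra.
  + have F := fin3 (ltW (lt_trans m01 m)) (ltW m) (ltW m23) n; lra.
  + have F := fin4 (ltW (lt_trans m01 (lt_trans m n))) (ltW (lt_trans m n)) (ltW (lt_trans m23 n)) (ltW n); lra.
Qed.

(** An axiomatic version of the window: [Q] is the mass of a box at the origin, [I4] that of the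
    quadrant, [H] that of the half-axis and [tau] that of a tail beyond [c]. The linear strip
    estimate is used up to width [b], and [nu] stands for n. *)
Variables (Q : R -> R -> R) (W : R * R -> R) (I4 H p tau c b nu : R).
Hypothesis mW : measurable_fun [set: T * T] W.
Hypothesis WE : forall x1 x2, 0 <= x1 <= 1 -> 0 <= x2 <= 1 ->
  W (x1, x2) = Q x1 x2 + Q (1 - x1) x2 + (Q x1 (1 - x2) + Q (1 - x1) (1 - x2)).
Hypothesis QC : forall u v, Q u v = Q v u.
Hypothesis Q_ge0 : forall u v, 0 <= Q u v.
Hypothesis Q_le : forall u v, Q u v <= I4.
Hypothesis Q_le_strip : forall u v, 0 <= u -> Q u v <= u * H.
Hypothesis Q_ge_strip : forall u u' v, 0 <= u -> u <= u' -> c <= v ->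
  u * H - u * u * p - tau <= Q u' v.
Hypothesis Q_ge_tail : forall u v, c <= u -> c <= v -> I4 - 2 * tau <= Q u v.
Hypothesis tau_ge0 : 0 <= tau.
Hypothesis p_ge0 : 0 <= p.
Hypothesis c_gt0 : 0 < c.
Hypothesis c_le : c <= 2^-1.
Hypothesis b_ge0 : 0 <= b.
Hypothesis nu_gt0 : 0 < nu.

Let V (x1 x2 : R) := expR (- (nu * W (x1, x2))).

Let V_sym1 x1 x2 : 0 <= x1 <= 1 -> 0 <= x2 <= 1 -> V (1 - x1) x2 = V x1 x2.
Proof.
move=> h1 h2; rewrite /V !WE//; last by move: h1 => /andP[? ?]; apply/andP; split; lra.
by rewrite subKr; congr expR; congr (- (_ * _)); ring.
Qed.

Let V_swap x1 x2 : 0 <= x1 <= 1 -> 0 <= x2 <= 1 -> V x2 x1 = V x1 x2.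
Proof.
move=> h1 h2; rewrite /V !WE// (QC x2 x1) (QC (1 - x2) x1) (QC x2 (1 - x1)) (QC (1 - x2) (1 - x1)).
by congr expR; congr (- (_ * _)); ring.
Qed.

Let iV : (leb2 R).-integrable (@unit_square R) (EFin \o (fun x => expR (- (nu * W x)))).
Proof.
apply: (@square_bounded_integrable _ _ 1).
  apply: (measurableT_comp (@measurable_expR R)); apply: measurable_funN.
  by apply: measurable_funM => //; exact: measurable_cst.
move=> [x1 x2] [/=]; rewrite !in_itv/= => h1 h2; rewrite ger0_norm ?expR_ge0//.
by rewrite expR_le1 oppr_le0 mulr_ge0 ?(ltW nu_gt0)// WE// !addr_ge0.
Qed.

(** One factor [q] for each quarter of the total mass that the window sees: [q ^+ 4] in the
    interior, [q ^+ 2] at a side, [q] at a corner. The rate [k] below comes from the two strips next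
    to a side, each of mass at most [x1 * H]. *)
Let q := expR (- (nu * I4)).

Let k := 2 * nu * H.

(** The integrand dominates five functions, one for the centre and one for each side, and
    [max_sqr_lower] is applied to their square roots. Among the subtracted products, centre times
    side gives [q ^+ 3], opposite sides collapse to the constant [q ^+ 2 * expR (- (k / 2))], and
    adjacent sides factor over the two coordinates. *)
Lemma outer_integral_ge : 0 < H ->
  q ^+ 4 + 2 * q ^+ 2 * edge_mass k -
  (2 * q ^+ 3 * edge_mass (k / 2) + 2 * q ^+ 2 * expR (- (k / 2)) + q ^+ 2 * edge_mass (k / 2) ^+ 2)
  <= \int[leb2 R]_(x in @unit_square R) expR (- (nu * W x)).
Proof.
move=> H0; have k0 : 0 < k by rewrite !mulr_gt0.
have k20 : 0 < k / 2 by rewrite divr_gt0.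
have V_edge x1 x2 : 0 <= x1 <= 1 -> 0 <= x2 <= 1 -> q ^+ 2 * expR (- (k * x1)) <= V x1 x2.
  move=> h1 h2; rewrite /q -expRM_natl -expRD ler_expR WE//.
  have x10 : 0 <= x1 by case/andP: h1.
  have := Q_le_strip x2 x10; have := Q_le_strip (1 - x2) x10.
  have := Q_le (1 - x1) x2; have := Q_le (1 - x1) (1 - x2) => a1 a2 a3 a4.
  have : nu * (Q x1 x2 + Q (1 - x1) x2 + (Q x1 (1 - x2) + Q (1 - x1) (1 - x2))) <=
      nu * (2 * I4 + 2 * (x1 * H)) by rewrite ler_pM2l//; lra.
  by rewrite /k; lra.
have V_cen x1 x2 : 0 <= x1 <= 1 -> 0 <= x2 <= 1 -> q ^+ 4 <= V x1 x2.
  move=> h1 h2; rewrite /q -expRM_natl ler_expR WE//.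
  have := Q_le x1 x2; have := Q_le x1 (1 - x2).
  have := Q_le (1 - x1) x2; have := Q_le (1 - x1) (1 - x2) => a1 a2 a3 a4.
  have : nu * (Q x1 x2 + Q (1 - x1) x2 + (Q x1 (1 - x2) + Q (1 - x1) (1 - x2))) <=
      nu * (4 * I4) by rewrite ler_pM2l//; lra.
  by lra.
have f1 := @edge_factor1 R; have fk := edge_factor_exp k0; have fh := edge_factor_exp k20.
have := square_integral_eqD (square_integral_eqD
  (square_integral_eqZ (q ^+ 4) (square_integral_eq_prod f1 f1))
  (square_integral_eqZ (q ^+ 2) (square_integral_eqD
    (square_integral_eq_prod fk f1) (square_integral_eq_prod f1 fk))))
  (square_integral_eqZ (-1) (square_integral_eqD (square_integral_eqD
    (square_integral_eqZ (q ^+ 3) (square_integral_eqD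
       (square_integral_eq_prod fh f1) (square_integral_eq_prod f1 fh)))
    (square_integral_eqZ (2 * q ^+ 2 * expR (- (k / 2))) (square_integral_eq_prod f1 f1)))
    (square_integral_eqZ (q ^+ 2) (square_integral_eq_prod fh fh)))).
move=> /square_integral_ge/(_ iV) HG.
apply: le_trans (HG _); first by rewrite le_eqVlt; apply/orP; left; apply/eqP; ring.
move=> [x1 x2] [/=]; rewrite !in_itv/= => h1 h2.
have h1' : 0 <= 1 - x1 <= 1 by move: h1 => /andP[? ?]; apply/andP; split; lra.
have h2' : 0 <= 1 - x2 <= 1 by move: h2 => /andP[? ?]; apply/andP; split; lra.
have sq t : expR (- (k * t)) = expR (- (k / 2 * t)) ^+ 2.
  by rewrite -expRM_natl; congr expR; field.
have opp t : expR (- (k / 2 * t)) * expR (- (k / 2 * (1 - t))) = expR (- (k / 2)).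
  by rewrite -expRD; congr expR; ring.
have := @max_sqr_lower (q ^+ 2) (q * expR (- (k / 2 * x1))) (q * expR (- (k / 2 * (1 - x1))))
  (q * expR (- (k / 2 * x2))) (q * expR (- (k / 2 * (1 - x2)))) (V x1 x2).
have q0 : 0 <= q by exact: expR_ge0.
have g t : 0 <= q * expR (- (k / 2 * t)) by rewrite mulr_ge0// expR_ge0.
have g2 t : q ^+ 2 * expR (- (k * t)) = (q * expR (- (k / 2 * t))) ^+ 2 by rewrite exprMn sq.
have E1 := V_edge _ _ h1 h2; rewrite g2 in E1.
have E2 := V_edge _ _ h1' h2; rewrite V_sym1// g2 in E2.
have E3 := V_edge _ _ h2 h1; rewrite V_swap// g2 in E3.
have E4 := V_edge _ _ h2' h1; rewrite V_sym1// V_swap// g2 in E4.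
have E0 : (q ^+ 2) ^+ 2 <= V x1 x2 by rewrite -exprM; exact: V_cen.
move=> /(_ (exprn_ge0 2 q0) (g _) (g _) (g _) (g _) E0 E1 E2 E3 E4).
apply: le_trans; rewrite le_eqVlt; apply/orP; left; apply/eqP.
rewrite /edge_exp /cst /=.
have o1 := opp x1; have o2 := opp x2.
rewrite (sq x1) (sq (1 - x1)) (sq x2) (sq (1 - x2)) -/k.
move: o1 o2.
set d1 := expR (- (k / 2 * x1)); set d2 := expR (- (k / 2 * (1 - x1))).
set d3 := expR (- (k / 2 * x2)); set d4 := expR (- (k / 2 * (1 - x2))).
move: d1 d2 d3 d4 => d1 d2 d3 d4.
move: q => z o1 o2.
have -> : z * d1 * (z * d2) = z ^+ 2 * (d1 * d2) by ring.
have -> : z * d3 * (z * d4) = z ^+ 2 * (d3 * d4) by ring.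
by rewrite o1 o2; ring.
Qed.

(* [1 <= cutoff x] whenever [x] is within distance [c] of [0] or [1]; an
   exponential avoids integrating indicators. *)
Let cutoff (x : R) := expR 1 * edge_exp c^-1 x.

Let cutoff_ge0 x : 0 <= cutoff x.
Proof. by rewrite mulr_ge0 ?expR_ge0 ?edge_exp_ge0. Qed.

Let cutoff_ge1 x : x <= c -> 1 <= cutoff x.
Proof.
move=> xc; rewrite /cutoff /edge_exp mulrDr -expRD.
have : 1 <= expR (1 + - (c^-1 * x)).
  by rewrite -[leLHS]expR0 ler_expR subr_ge0 mulrC ler_pdivrMr// mul1r.
have : 0 <= expR 1 * expR (- (c^-1 * (1 - x))) by rewrite mulr_ge0 ?expR_ge0.
by lra.
Qed.

(** For [x1 <= b] the loss [x1 * x1 * p] is at most [x1 * b * p], which lowers the slope [H] to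
    [H - b * p]. The 8 in [A] covers the worst case, four quadrants each short of at most two
    tails. *)
Let kb := 2 * nu * (H - b * p).

Let A := expR (8 * nu * tau).

(** One summand per region: the interior, the sides up to depth [b], the sides between [b] and [c],
    where the decay is frozen at its value at [b], and the corners, where both coordinates are
    within [c] of an end. *)
Let upper (x1 x2 : R) := A * (q ^+ 4 + q ^+ 2 *
  (edge_exp kb x1 + edge_exp kb x2 + expR (- (kb * b)) * (cutoff x1 + cutoff x2)) +
  q * (cutoff x1 * cutoff x2)).

Let upper_sym1 x1 x2 : upper (1 - x1) x2 = upper x1 x2.
Proof. by rewrite /upper /cutoff !edge_exp_sym. Qed.

Let upper_swap x1 x2 : upper x2 x1 = upper x1 x2.
Proof. by rewrite /upper [cutoff x2 + _]addrC [edge_exp _ x2 + _]addrC [cutoff x2 * _]mulrC. Qed.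

Hypothesis Hb : b * p < H.

Let q_ge0 : 0 <= q. Proof. exact: expR_ge0. Qed.

Let A_ge0 : 0 <= A. Proof. exact: expR_ge0. Qed.

Let V_le_of (x1 x2 m s : R) : 0 <= x1 <= 1 -> 0 <= x2 <= 1 ->
  m * I4 + s - 8 * tau <= W (x1, x2) -> V x1 x2 <= A * (expR (- (nu * (m * I4))) * expR (- (nu * s))).
Proof.
move=> h1 h2 h; rewrite /V /A -!expRD ler_expR.
have : nu * (m * I4 + s - 8 * tau) <= nu * W (x1, x2) by rewrite ler_pM2l.
by lra.
Qed.

Let edge_case x1 x2 : 0 <= x1 <= c -> c <= x2 <= 2^-1 -> V x1 x2 <= upper x1 x2.
Proof.
move=> /andP[x10 x1c] /andP[cx2 x2h].
have h1 : 0 <= x1 <= 1 by apply/andP; split; lra.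
have h2 : 0 <= x2 <= 1 by apply/andP; split; lra.
have t1 : I4 - 2 * tau <= Q (1 - x1) x2 by apply: Q_ge_tail; lra.
have t2 : I4 - 2 * tau <= Q (1 - x1) (1 - x2) by apply: Q_ge_tail; lra.
have cx2' : c <= 1 - x2 by lra.
have C1 := cutoff_ge1 x1c.
have e2 := edge_exp_ge0 kb x2; have C2 := cutoff_ge0 x2.
have qE : q ^+ 2 = expR (- (nu * (2 * I4))) by rewrite /q -expRM_natl; congr expR; ring.
have eb0 := expR_ge0 (- (kb * b)).
(* [s] is the mass guaranteed by the two strips next to the side: linear in [x1] up to [b], and
   frozen from there on, where the cutoff term of [upper] takes over. *)
suff [s hs es] : exists2 s, 2 * I4 + s - 8 * tau <= W (x1, x2) &
    expR (- (nu * s)) <= edge_exp kb x1 + expR (- (kb * b)) * cutoff x1.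
  apply: le_trans (V_le_of h1 h2 hs) _; rewrite -qE /upper ler_wpM2l//.
  have : q ^+ 2 * expR (- (nu * s)) <= q ^+ 2 * (edge_exp kb x1 + expR (- (kb * b)) * cutoff x1).
    by rewrite ler_wpM2l// exprn_ge0.
  have := mulr_ge0 (exprn_ge0 2 q_ge0) e2.
  have := mulr_ge0 (exprn_ge0 2 q_ge0) (mulr_ge0 eb0 C2).
  have := mulr_ge0 q_ge0 (mulr_ge0 (cutoff_ge0 x1) C2).
  have := exprn_ge0 4 q_ge0.
  by lra.
rewrite WE//; have [xb|bx] := lerP x1 b.
- have s1 := Q_ge_strip x10 (lexx x1) cx2; have s2 := Q_ge_strip x10 (lexx x1) cx2'.
  exists (2 * (x1 * (H - b * p))).
    have : x1 * x1 * p <= x1 * b * p by rewrite ler_wpM2r// ler_wpM2l.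
    by move: s1 s2 t1 t2 tau_ge0; lra.
  rewrite (_ : nu * _ = kb * x1); last by rewrite /kb; ring.
  have := expR_ge0 (- (kb * (1 - x1))); have := mulr_ge0 eb0 (cutoff_ge0 x1).
  by rewrite /edge_exp; lra.
- have s1 := Q_ge_strip b_ge0 (ltW bx) cx2; have s2 := Q_ge_strip b_ge0 (ltW bx) cx2'.
  exists (2 * (b * (H - b * p))); first by move: s1 s2 t1 t2 tau_ge0; lra.
  rewrite (_ : nu * _ = kb * b); last by rewrite /kb; ring.
  have := edge_exp_ge0 kb x1; have : expR (- (kb * b)) * 1 <= expR (- (kb * b)) * cutoff x1.
    by rewrite ler_wpM2l.
  by lra.
Qed.

Let V_le_upper_half x1 x2 : 0 <= x1 <= 2^-1 -> 0 <= x2 <= 2^-1 -> V x1 x2 <= upper x1 x2.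
Proof.
move=> /andP[x10 x1h] /andP[x20 x2h].
have h1 : 0 <= x1 <= 1 by apply/andP; split; lra.
have h2 : 0 <= x2 <= 1 by apply/andP; split; lra.
have [x1c|cx1] := lerP x1 c; have [x2c|cx2] := lerP x2 c.
- have t : I4 - 2 * tau <= Q (1 - x1) (1 - x2) by apply: Q_ge_tail; move: c_le; lra.
  have hs : 1 * I4 + 0 - 8 * tau <= W (x1, x2).
    rewrite WE//; have := Q_ge0 x1 x2; have := Q_ge0 x1 (1 - x2); have := Q_ge0 (1 - x1) x2.
    by move: tau_ge0; lra.
  apply: le_trans (V_le_of h1 h2 hs) _; rewrite mulr0 oppr0 expR0 mulr1 mul1r -/q /upper ler_wpM2l//; clear hs t.
  have C1 := cutoff_ge1 x1c; have C2 := cutoff_ge1 x2c.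
  have CC : 1 <= cutoff x1 * cutoff x2 by rewrite -[1]mulr1 ler_pM.
  have : q * 1 <= q * (cutoff x1 * cutoff x2) by rewrite ler_wpM2l.
  rewrite mulr1.
  have : 0 <= q ^+ 2 * (edge_exp kb x1 + edge_exp kb x2 + expR (- (kb * b)) * (cutoff x1 + cutoff x2)).
    by rewrite mulr_ge0 ?exprn_ge0// !addr_ge0 ?edge_exp_ge0// mulr_ge0 ?expR_ge0// addr_ge0.
  have := exprn_ge0 4 q_ge0.
  by lra.
- by apply: edge_case; apply/andP; split=> //; exact: ltW.
- by rewrite -V_swap// -upper_swap; apply: edge_case; apply/andP; split=> //; exact: ltW.
- have hs : 4 * I4 + 0 - 8 * tau <= W (x1, x2).
    rewrite WE//; have t1 : I4 - 2 * tau <= Q x1 x2 by apply: Q_ge_tail; lra.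
    have t2 : I4 - 2 * tau <= Q (1 - x1) x2 by apply: Q_ge_tail; lra.
    have t3 : I4 - 2 * tau <= Q x1 (1 - x2) by apply: Q_ge_tail; lra.
    have t4 : I4 - 2 * tau <= Q (1 - x1) (1 - x2) by apply: Q_ge_tail; lra.
    by lra.
  apply: le_trans (V_le_of h1 h2 hs) _; rewrite mulr0 oppr0 expR0 mulr1 /upper ler_wpM2l//; clear hs.
  have -> : expR (- (nu * (4 * I4))) = q ^+ 4 by rewrite /q -expRM_natl; congr expR; ring.
  have := mulr_ge0 q_ge0 (mulr_ge0 (cutoff_ge0 x1) (cutoff_ge0 x2)).
  have : 0 <= q ^+ 2 * (edge_exp kb x1 + edge_exp kb x2 + expR (- (kb * b)) * (cutoff x1 + cutoff x2)).
    by rewrite mulr_ge0 ?exprn_ge0// !addr_ge0 ?edge_exp_ge0// mulr_ge0 ?expR_ge0// addr_ge0.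
  by lra.
Qed.

Let V_le_upper x1 x2 : 0 <= x1 <= 1 -> 0 <= x2 <= 1 -> V x1 x2 <= upper x1 x2.
Proof.
have half y1 y2 : 0 <= y1 <= 1 -> 0 <= y2 <= 2^-1 -> V y1 y2 <= upper y1 y2.
  move=> h1 h2; have h2' : 0 <= y2 <= 1 by move: h2 => /andP[? ?]; apply/andP; split; lra.
  have [yh|yh] := lerP y1 2^-1.
    by apply: V_le_upper_half => //; move: h1 => /andP[-> _].
  rewrite -V_sym1// -upper_sym1; apply: V_le_upper_half => //.
  by move: h1 => /andP[? ?]; apply/andP; split; lra.
move=> h1 h2; have [yh|yh] := lerP x2 2^-1.
  by apply: half => //; move: h2 => /andP[-> _].
rewrite -V_swap// -upper_swap -V_sym1// -upper_sym1 V_swap//; last first.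
  by move: h2 => /andP[? ?]; apply/andP; split; lra.
rewrite upper_swap; apply: half => //.
by move: h2 => /andP[? ?]; apply/andP; split; lra.
Qed.

Lemma outer_integral_le :
  \int[leb2 R]_(x in @unit_square R) expR (- (nu * W x)) <=
  A * (q ^+ 4 + q ^+ 2 * (2 * edge_mass kb + expR (- (kb * b)) * (2 * expR 1 * edge_mass c^-1)) +
    q * (expR 1 * edge_mass c^-1) ^+ 2).
Proof.
have kb0 : 0 < kb by rewrite !mulr_gt0// subr_gt0.
have c0 : 0 < c^-1 by rewrite invr_gt0.
have f1 := @edge_factor1 R; have fk := edge_factor_exp kb0; have fc := edge_factor_exp c0.
have sc1 := square_integral_eqZ (expR 1) (square_integral_eq_prod fc f1).
have sc2 := square_integral_eqZ (expR 1) (square_integral_eq_prod f1 fc).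
have sk := square_integral_eqD (square_integral_eq_prod fk f1) (square_integral_eq_prod f1 fk).
have scc := square_integral_eqZ (expR 1 * expR 1) (square_integral_eq_prod fc fc).
have := square_integral_eqZ A (square_integral_eqD (square_integral_eqD
  (square_integral_eqZ (q ^+ 4) (square_integral_eq_prod f1 f1))
  (square_integral_eqZ (q ^+ 2) (square_integral_eqD sk
    (square_integral_eqZ (expR (- (kb * b))) (square_integral_eqD sc1 sc2)))))
  (square_integral_eqZ q scc)).
move=> /square_integral_le/(_ iV) HG.
apply: (le_trans (HG _)); last by rewrite le_eqVlt; apply/orP; left; apply/eqP; ring.
move=> [x1 x2] [/=]; rewrite !in_itv/= => h1 h2.
apply: (le_trans (V_le_upper h1 h2)).
rewrite le_eqVlt; apply/orP; left; apply/eqP.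
by rewrite /upper /cutoff /cst; ring.
Qed.

End outer.

(** * Decay, range and shape constants of a connection function *)

Section profile.
Context {R : realType}.
Let mu := @lebesgue_measure R.

(** With k > 4 / eta one has [s ^+ 4 <= (s ^ eta) ^+ k] for s >= 1, and exp y dominates y^k / k!.
    The factor 16 comes from 1 + s being at most twice the larger of 1 and s. *)
Lemma expR_powR_decay (eta : R) : 0 < eta ->
  exists2 C : R, 0 < C & forall s, 0 <= s -> (1 + s) ^+ 4 * expR (- eta * s `^ eta) <= C.
Proof.
move=> eta0; pose k := (Num.truncn (4 / eta)).+1.
pose C := 16 * (1 + k`!%:R / eta ^+ k).
have kf0 : 0 <= k`!%:R / eta ^+ k by rewrite divr_ge0// exprn_ge0// ltW.
exists C; first by rewrite mulr_gt0// ltr_wpDr.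
move=> s s0; rewrite mulNr expRN ler_pdivrMr ?expR_gt0//.
have y0 : 0 <= s `^ eta by exact: powR_ge0.
have ey0 : 0 <= eta * s `^ eta by rewrite mulr_ge0// ltW.
have e1 : 1 <= expR (eta * s `^ eta) by rewrite -[leLHS]expR0 ler_expR.
have [s1|s1] := leP s 1.
  apply: (@le_trans _ _ (16 * 1)).
    rewrite mulr1 (_ : 16 = 2 ^+ 4); last by ring.
    by rewrite lerXn2r// ?nnegrE; lra.
  by rewrite ler_pM// /C; lra.
have h : s ^+ 4 <= (s `^ eta) ^+ k.
  rewrite -!powR_mulrn// -powRrM; apply: ler_powR; first exact: ltW.
  by rewrite -ler_pdivrMl// mulrC ltW// truncnS_gt.
have h2 : (eta * s `^ eta) ^+ k <= k`!%:R * expR (eta * s `^ eta).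
  have := @expR_ge1Dxn R (eta * s `^ eta) (Num.truncn (4 / eta)) ey0.
  rewrite -/k => h3; rewrite -ler_pdivrMl ?ltr0n ?fact_gt0//.
  by rewrite mulrC; lra.
have h4 : (1 + s) ^+ 4 <= 16 * s ^+ 4.
  rewrite (_ : 16 * s ^+ 4 = (2 * s) ^+ 4); last by ring.
  by rewrite lerXn2r// ?nnegrE; lra.
have h5 : (s `^ eta) ^+ k <= k`!%:R / eta ^+ k * expR (eta * s `^ eta).
  rewrite mulrAC ler_pdivlMr ?exprn_gt0//.
  by rewrite mulrC -exprMn.
by rewrite /C; lra.
Qed.

(** The infinite cases agree as well: [c > 0] preserves them and [fine] sends them to 0. *)
Lemma fine_scale (c : R) (x : \bar R) : 0 < c -> fine (c%:E * x)%E = c * fine x.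
Proof.
by move=> c0; case: x => [x| |] //=; rewrite ?gt0_muley ?gt0_muleNy ?mulr0 ?lte_fin.
Qed.

Lemma enorm2_ge (a b : R) : a <= enorm2 (a, b).
Proof.
by rewrite (le_trans (ler_norm a))// -sqrtr_sqr /enorm2/= ler_wsqrtr// lerDl sqr_ge0.
Qed.

Lemma enorm2_axis (a : R) : 0 <= a -> enorm2 (a, 0) = a.
Proof. by move=> a0; rewrite /enorm2/= expr0n addr0 sqrtr_sqr ger0_norm. Qed.

Variables (eta : R) (phi : R * R -> R).
Hypothesis eta_gt0 : 0 < eta.
Hypothesis phi_Phi : Phi2 eta phi.
Hypothesis phi_Psi : Psi2 phi.

Let p := conn_sup phi.
Let r := rho eta phi.

Let m_phi : measurable_fun [set: R * R] phi.
Proof. by case: phi_Phi => -[]. Qed.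

Let phi_ge0 x : 0 <= phi x.
Proof. by case: phi_Phi => -[_ /(_ x)/andP[]]. Qed.

Let phi_mono x y : enorm2 x <= enorm2 y -> phi y <= phi x.
Proof. by case: phi_Psi => _; apply. Qed.

Let phi_radial x y : enorm2 x = enorm2 y -> phi x = phi y.
Proof. by move=> xy; apply/eqP; rewrite eq_le !phi_mono// xy. Qed.

Let phi_le x : phi x <= p.
Proof.
apply: sup_ubound; last by exists x.
by exists 1 => _ [y _ <-]; case: phi_Phi => -[_ /(_ y)/andP[]].
Qed.

Lemma rho_extE : rho_ext eta phi = r%:E.
Proof.
rewrite /r /rho fineK//; case: phi_Phi => _ /andP[r0 roo] _.
by rewrite ge0_fin_numE// ltW.
Qed.

Lemma rho_gt0 : 0 < r.
Proof. by rewrite -lte_fin -rho_extE; case: phi_Phi => _ /andP[]. Qed.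

Lemma phi_ge_inside x : enorm2 x < r -> eta * p <= phi x.
Proof.
move=> xr; rewrite leNgt; apply/negP => px.
have : (rho_ext eta phi <= (enorm2 x)%:E)%E by apply: ereal_inf_lbound; exists x.
by rewrite rho_extE lee_fin leNgt xr.
Qed.

(** With a nonpositive supremum the threshold [eta * p] is never undercut, and the infimum over the
    empty set is [+oo], which [Phi2] excludes. *)
Lemma conn_sup_gt0 : 0 < p.
Proof.
rewrite ltNge; apply/negP => p0.
have : rho_ext eta phi = +oo%E.
  rewrite /rho_ext (_ : [set _ | _ in _] = set0) ?ereal_inf0//.
  apply/seteqP; split => // _ [x /= + _]; rewrite ltNge => /negP[]; apply: le_trans (phi_ge0 x).
  by rewrite mulr_ge0_le0// ltW.
by rewrite rho_extE.
Qed.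

(** Both coordinates are at most the norm, so the fourth power in the hypothesis dominates one
    square in each coordinate. *)
Lemma phi_poly_decay (C : R) :
  (forall s, 0 <= s -> (1 + s) ^+ 4 * expR (- eta * s `^ eta) <= C) ->
  forall a b : R, 0 <= a -> 0 <= b ->
  phi (a, b) <= (3 * eta^-1 * C * p) * (r ^+ 2 / (r + a) ^+ 2) * (r ^+ 2 / (r + b) ^+ 2).
Proof.
move=> hC a b a0 b0; have r0 := rho_gt0; have p0 := conn_sup_gt0.
case: phi_Phi => _ _ /(_ (a, b)) /le_trans; apply; rewrite -/p -/r.
set s := enorm2 (a, b) / r.
have sa : a / r <= s by rewrite ler_pM2r ?invr_gt0// enorm2_ge.
have sb : b / r <= s.
  rewrite ler_pM2r ?invr_gt0// (_ : enorm2 (a, b) = enorm2 (b, a)) ?enorm2_ge//.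
  by rewrite /enorm2/= addrC.
have ar0 : 0 <= a / r by rewrite divr_ge0// ltW.
have br0 : 0 <= b / r by rewrite divr_ge0// ltW.
have s0 : 0 <= s by exact: le_trans sa.
have sq4 : (1 + a / r) ^+ 2 * (1 + b / r) ^+ 2 <= (1 + s) ^+ 4.
  rewrite (_ : (1 + s) ^+ 4 = (1 + s) ^+ 2 * (1 + s) ^+ 2); last by rewrite -exprD.
  by apply: ler_pM; rewrite ?sqr_ge0// lerXn2r ?nnegrE//; lra.
have ra (x : R) : 0 <= x -> r ^+ 2 / (r + x) ^+ 2 = ((1 + x / r) ^+ 2)^-1.
  move=> x0; rewrite -[r ^+ 2 / _]invrK invf_div -expr_div_n; congr ((_ ^+ 2)^-1).
  by rewrite mulrDl divff// gt_eqF.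
rewrite !ra// -!mulrA -invfM mulrA [3 * (_ * (_ * _))]mulrA.
have hh : expR (- eta * s `^ eta) <= C * ((1 + a / r) ^+ 2 * (1 + b / r) ^+ 2)^-1.
  rewrite ler_pdivlMr; last by rewrite mulr_gt0// exprn_gt0//; lra.
  by apply: le_trans (hC s s0); rewrite mulrC ler_wpM2r// expR_ge0.
have : 3 * eta^-1 * p * expR (- eta * s `^ eta) <=
   3 * eta^-1 * p * (C * ((1 + a / r) ^+ 2 * (1 + b / r) ^+ 2)^-1).
  by rewrite ler_wpM2l// !mulr_ge0 ?invr_ge0 ?(ltW eta_gt0) ?(ltW p0).
move=> h; apply: le_trans (le_trans h _); rewrite le_eqVlt; apply/orP; left; apply/eqP; ring.
Qed.

Let msec (y : measurableTypeR R) :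
  measurable_fun setT (fun t : measurableTypeR R => phi (t, y)).
Proof.
have m : measurable_fun [set: measurableTypeR R * measurableTypeR R] phi by exact: m_phi.
exact: (measurableT_comp m (pair2_measurable y)).
Qed.

Let msecE (y : measurableTypeR R) :
  measurable_fun setT (fun t : measurableTypeR R => (phi (t, y))%:E).
Proof. by apply/measurable_EFinP; exact: msec. Qed.

Let msec2 (y : measurableTypeR R) (c : R) :
  measurable_fun setT (fun t : measurableTypeR R => phi (c * t, y)).
Proof.
have mc : measurable_fun setT ((fun t => c * t) : measurableTypeR R -> measurableTypeR R)
  := @mulrl_measurable _ _ _.
exact: (measurableT_comp (msec y) mc).
Qed.

Lemma J1E : fine (\int[mu]_(b in `[0%R, +oo[) (phi (0%R, b))%:E)%E = r * p * J1 eta phi.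
Proof.
have p0 := conn_sup_gt0; have r0 := rho_gt0.
rewrite (_ : (\int[mu]_(b in _) _ = \int[mu]_(b in `[0%R, +oo[) (phi (b, 0%R))%:E)%E); last first.
  by apply: eq_integral => b _; congr (_%:E); apply: phi_radial; rewrite /enorm2/= addrC.
rewrite (@ge0_integral_scale _ r (fun b => (phi (b, 0))%:E))//; [|exact: msecE|by move=> x; rewrite lee_fin].
by rewrite fine_scale// /J1 -/p -/r mulrA mulfK// gt_eqF.
Qed.

(** Four quadrants of angle pi / 2 account for the factor 2 pi in [J2]; rescaling the radius by [r]
    gives [r ^+ 2]. *)
Lemma J2E : 4 * fine (quad_integral phi `[0%R, +oo[ `[0%R, +oo[) = r ^+ 2 * p * J2 eta phi.
Proof.
have p0 := conn_sup_gt0; have r0 := rho_gt0.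
have pi0 : pi != 0 :> R by rewrite gt_eqF// pi_gt0.
have rn0 : r != 0 by rewrite gt_eqF.
have pn0 : p != 0 by rewrite gt_eqF.
have mfE : measurable_fun [set: measurableTypeR R * measurableTypeR R] (fun z => (phi z)%:E).
  exact/measurable_EFinP.
have f0 x : (0 <= (phi x)%:E)%E by rewrite lee_fin.
have fr x y : enorm2 x = enorm2 y -> (phi x)%:E = (phi y)%:E.
  by move=> xy; rewrite (phi_radial xy).
rewrite quad_integralE (polar_quadrant mfE f0 fr).
have mn : measurable_fun setT (fun t : measurableTypeR R => (`|t|%:E * (phi (t, 0))%:E)%E).
  apply: emeasurable_funM; last exact: msecE.
  by apply/measurable_EFinP; exact: normr_measurable.
rewrite (_ : (\int[mu]_(t in _) _ = \int[mu]_(t in `[0%R, +oo[) (`|t|%:E * (phi (t, 0%R))%:E))%E); last first.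
  by apply: eq_integral => t; rewrite inE/= in_itv/= andbT => t0; rewrite ger0_norm.
rewrite (@ge0_integral_scale _ r)//; last by move=> x; rewrite mule_ge0// lee_fin.
rewrite /J2 /Rintegral -/p -/r.
have mmul (y : measurableTypeR R) : measurable_fun setT
    (fun t : measurableTypeR R => (phi (r * t, y) * (2 * pi * t))%:E).
  apply/measurable_EFinP; apply: measurable_funM; first exact: msec2.
  exact: mulrl_measurable.
have -> : (\int[mu]_(t in `[0%R, +oo[) (`|r * t|%:E * (phi (r * t, 0)%R)%:E) =
   (r / (2 * pi))%:E * \int[mu]_(t in `[0%R, +oo[) (phi (r * t, 0) * (2 * pi * t))%:E)%E.
  rewrite -ge0_integralZl//.
  - apply: eq_integral => t; rewrite inE/= in_itv/= andbT => t0.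
    rewrite -!EFinM ger0_norm; last by rewrite mulr_ge0// ltW.
    by congr (_%:E); move: pi0; generalize (@pi R) => P P0; field.
  - by apply: measurable_funTS; exact: (mmul 0).
  - move=> t; rewrite /= in_itv/= andbT => t0; rewrite lee_fin !mulr_ge0//; exact: pi_ge0.
  - by rewrite lee_fin divr_ge0 ?mulr_ge0 ?pi_ge0// ltW.
rewrite !fine_scale ?divr_gt0 ?mulr_gt0 ?pi_gt0//.
by move: pi0; generalize (@pi R) => P P0; field; rewrite ?P0 ?pn0.
Qed.

Lemma axis_integral_ge : ((r * p * eta)%:E <= \int[mu]_(b in `[0%R, +oo[) (phi (0%R, b))%:E)%E.
Proof.
have r0 := rho_gt0.
rewrite (_ : (\int[mu]_(b in _) _ = \int[mu]_(b in `[0%R, +oo[) (phi (b, 0%R))%:E)%E); last first.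
  by apply: eq_integral => b _; congr (_%:E); apply: phi_radial; rewrite /enorm2/= addrC.
apply: (@le_trans _ _ (\int[mu]_(b in `[0%R, r[) (phi (b, 0%R))%:E)%E); last first.
  apply: ge0_subset_integral => //; first by apply: measurable_funTS; exact: msecE.
    by move=> b _; rewrite lee_fin.
  by move=> b; rewrite /= !in_itv/= andbT => /andP[].
apply: (@le_trans _ _ (\int[mu]_(b in `[0%R, r[) cst (eta * p)%:E b)%E).
  rewrite integral_cst// [X in (_ * X)%E]lebesgue_measure_itv/= lte_fin r0 oppr0 adde0 -EFinM.
  by rewrite lee_fin le_eqVlt; apply/orP; left; apply/eqP; ring.
have ep0 : 0 <= eta * p by rewrite mulr_ge0 ?(ltW eta_gt0) ?(ltW conn_sup_gt0).
apply: ge0_le_integral => //; try by move=> b _; rewrite lee_fin.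
  by apply: measurable_funTS; exact: msecE.
move=> b; rewrite /= in_itv/= => /andP[b0 br]; rewrite lee_fin phi_ge_inside//.
by rewrite enorm2_axis.
Qed.

Variable C : R.
Hypothesis C_gt0 : 0 < C.
Hypothesis C_decay : forall s, 0 <= s -> (1 + s) ^+ 4 * expR (- eta * s `^ eta) <= C.

Let K := 3 * eta^-1 * C.

Let K_gt0 : 0 < K.
Proof. by rewrite !mulr_gt0 ?invr_gt0. Qed.

Let Kp_ge0 : 0 <= K * p.
Proof. by rewrite mulr_ge0 ?(ltW K_gt0) ?(ltW conn_sup_gt0). Qed.

Let decay := phi_poly_decay C_decay.

Lemma conn_integralE : conn_integral phi = r ^+ 2 * p * J2 eta phi.
Proof.
rewrite -J2E; exact: (conn_integral_quad m_phi phi_ge0 phi_mono rho_gt0 Kp_ge0 decay).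
Qed.

Let I4E : fine (quad_integral phi `[0%R, +oo[ `[0%R, +oo[) = conn_integral phi / 4.
Proof. by rewrite conn_integralE -J2E; field. Qed.

Lemma J1_ge : eta <= J1 eta phi.
Proof.
have p0 := conn_sup_gt0; have r0 := rho_gt0.
have := axis_integral_ge.
rewrite -(fineK (axis_integral_fin m_phi phi_ge0 phi_mono phi_le rho_gt0 Kp_ge0 decay)) lee_fin.
by rewrite J1E ler_pM2l// mulr_gt0.
Qed.

Let strip u : 0 <= u -> u * (r * p * J1 eta phi) - u * u * p <= r ^+ 2 * p * J2 eta phi / 4.
Proof.
move=> u0; rewrite -conn_integralE -I4E -J1E.
exact: (quad_fine_ge_strip m_phi phi_ge0 phi_mono phi_le rho_gt0 Kp_ge0 decay u0).
Qed.

Lemma J2_le : J2 eta phi <= 4 * K.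
Proof.
have p0 := conn_sup_gt0; have r0 := rho_gt0.
have := quad_fine_le m_phi phi_ge0 rho_gt0 Kp_ge0 decay.
have rp0 : 0 < r ^+ 2 * p by rewrite mulr_gt0// exprn_gt0.
rewrite I4E conn_integralE ler_pdivrMr// (_ : _ * 4 = r ^+ 2 * p * (4 * K)); last by ring.
by rewrite ler_pM2l.
Qed.

Lemma J2_ge : eta ^+ 2 <= J2 eta phi.
Proof.
have p0 := conn_sup_gt0; have r0 := rho_gt0; have e0 := eta_gt0.
have rp0 : 0 < r ^+ 2 * p by rewrite mulr_gt0// exprn_gt0.
(* This width maximises [u * (r * p * eta) - u * u * p]; the maximum is a quarter of
   [r ^+ 2 * p * eta ^+ 2], which matches the four quadrants exactly. *)
have u0 : 0 <= r * eta / 2 by rewrite divr_ge0 ?mulr_ge0// ltW.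
have := strip u0.
have : r ^+ 2 * p * (eta * eta) <= r ^+ 2 * p * (eta * J1 eta phi).
  by rewrite ler_pM2l// ler_pM2l// J1_ge.
move=> a b; rewrite -(ler_pM2l rp0) expr2.
have -> : r ^+ 2 * p * (eta * eta) = 2 * (r ^+ 2 * p * (eta * eta)) - r ^+ 2 * p * (eta * eta) by ring.
move: b; rewrite (_ : _ - _ = r ^+ 2 * p * (eta * J1 eta phi) / 2 - r ^+ 2 * p * (eta * eta) / 4); last by field.
by lra.
Qed.

(** The strip of width [r] loses at most [r ^+ 2 * p], which is the summand 1; [J2_le] supplies
    [K]. *)
Lemma J1_le : J1 eta phi <= K + 1.
Proof.
have p0 := conn_sup_gt0; have r0 := rho_gt0.
have rp0 : 0 < r ^+ 2 * p by rewrite mulr_gt0// exprn_gt0.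
have := strip (ltW r0); have := J2_le; rewrite -(ler_pM2l rp0) => a b.
rewrite -(ler_pM2l rp0).
have : r * (r * p * J1 eta phi) - r * r * p = r ^+ 2 * p * J1 eta phi - r ^+ 2 * p by ring.
by lra.
Qed.

Let tau_of (c : R) := K * p * r * (r ^+ 2 / (r + c)).

Lemma conn_outer_ge (nu : R) : 0 < nu ->
  let q := expR (- (nu * (conn_integral phi / 4))) in
  let k := 2 * nu * (r * p * J1 eta phi) in
  q ^+ 4 + 2 * q ^+ 2 * edge_mass k -
  (2 * q ^+ 3 * edge_mass (k / 2) + 2 * q ^+ 2 * expR (- (k / 2)) + q ^+ 2 * edge_mass (k / 2) ^+ 2)
  <= \int[leb2 R]_(x in @unit_square R)
       expR (- (nu * \int[leb2 R]_(y in @unit_square R) phi (y - x))).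
Proof.
move=> nu0; rewrite -I4E -J1E.
apply: (@outer_integral_ge _ (box_integral phi) (fun x => \int[leb2 R]_(y in @unit_square R) phi (y - x))) => //.
- exact: measurable_window.
- by move=> x1 x2; exact: (window_box_integral m_phi phi_ge0 phi_mono rho_gt0 Kp_ge0 decay).
- exact: box_integralC.
- exact: box_integral_ge0.
- exact: (box_integral_le m_phi phi_ge0 rho_gt0 Kp_ge0 decay).
- exact: (box_integral_le_strip m_phi phi_ge0 phi_mono phi_le rho_gt0 Kp_ge0 decay).
- rewrite J1E; apply: mulr_gt0; last exact: lt_le_trans eta_gt0 J1_ge.
  by apply: mulr_gt0; [exact: rho_gt0|exact: conn_sup_gt0].
Qed.

Lemma conn_outer_le (nu c b : R) : 0 < nu -> 0 < c -> c <= 2^-1 -> 0 <= b ->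
  b * p < r * p * J1 eta phi ->
  let q := expR (- (nu * (conn_integral phi / 4))) in
  let k := 2 * nu * (r * p * J1 eta phi - b * p) in
  \int[leb2 R]_(x in @unit_square R)
       expR (- (nu * \int[leb2 R]_(y in @unit_square R) phi (y - x))) <=
  expR (8 * nu * tau_of c) *
  (q ^+ 4 + q ^+ 2 * (2 * edge_mass k + expR (- (k * b)) * (2 * expR 1 * edge_mass c^-1)) +
    q * (expR 1 * edge_mass c^-1) ^+ 2).
Proof.
move=> nu0 c0 c2 b0; rewrite -I4E -J1E => Hb.
apply: (@outer_integral_le _ (box_integral phi) (fun x => \int[leb2 R]_(y in @unit_square R) phi (y - x))) => //.
- exact: measurable_window.
- by move=> x1 x2; exact: (window_box_integral m_phi phi_ge0 phi_mono rho_gt0 Kp_ge0 decay).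
- exact: box_integralC.
- exact: box_integral_ge0.
- move=> u u' v u0 uu' cv.
  exact: (box_integral_ge_strip m_phi phi_ge0 phi_mono phi_le rho_gt0 Kp_ge0 decay u0 uu' (ltW c0) cv).
- move=> u v cu cv.
  exact: (box_integral_ge_tail m_phi phi_ge0 phi_mono rho_gt0 Kp_ge0 decay (ltW c0) cu cv).
- apply: mulr_ge0; first by apply: mulr_ge0; [exact: Kp_ge0|exact: ltW rho_gt0].
  by apply: divr_ge0; [exact: sqr_ge0|apply: addr_ge0; [exact: ltW rho_gt0|exact: ltW]].
- exact: ltW conn_sup_gt0.
Qed.

End profile.

(** * Explicit error bounds in powers of 1 / t *)

Section estimates.
Context {R : realType}.

Lemma expRN_le (k : nat) (y : R) : 0 < y -> expR (- y) <= k.+1`!%:R / y ^+ k.+1.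
Proof.
move=> y0; rewrite expRN -[leRHS]invrK lef_pV2 ?posrE ?expR_gt0 ?invr_gt0 ?divr_gt0 ?exprn_gt0 ?ltr0n ?fact_gt0//.
by rewrite invf_div (le_trans _ (expR_ge1Dxn k (ltW y0)))// lerDr.
Qed.

Lemma expRN_le_inv (y : R) : 0 < y -> expR (- y) <= y^-1.
Proof.
move=> y0; rewrite expRN lef_pV2 ?posrE ?expR_gt0//.
by rewrite (le_trans _ (expR_ge1Dx y))// lerDr.
Qed.

Lemma edge_mass_le (k : R) : 0 < k -> edge_mass k <= 2 / k.
Proof.
move=> k0; rewrite /edge_mass ler_pM2r ?invr_gt0//.
by have := expR_ge0 (- k); lra.
Qed.

Lemma edge_mass_ge0 (k : R) : 0 < k -> 0 <= edge_mass k.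
Proof.
move=> k0; rewrite /edge_mass divr_ge0 ?(ltW k0)// mulr_ge0// subr_ge0.
by rewrite expR_le1 oppr_le0 ltW.
Qed.

Variables (eta K a1 p r J1 J2 nu t x : R).
Hypothesis eta_gt0 : 0 < eta.
Hypothesis K_gt0 : 0 < K.
Hypothesis a1_gt0 : 0 < a1.
Hypothesis p_gt0 : 0 < p.
Hypothesis r_gt0 : 0 < r.
Hypothesis r_le1 : r <= 1.
Hypothesis nu_gt0 : 0 < nu.
Hypothesis t_ge1 : 1 <= t.
Hypothesis t_ge : 2 <= t * eta.
Hypothesis x_ge : t ^+ 2 / 2 <= x.
Hypothesis x_le : x <= 2 * t ^+ 2.
Hypothesis xE : x = nu * (r ^+ 2 * p * J2).
Hypothesis p_ge : a1 <= p * t ^+ 2.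
Hypothesis J1_lower : eta <= J1.
Hypothesis J1_upper : J1 <= K + 1.
Hypothesis J2_lower : eta ^+ 2 <= J2.
Hypothesis J2_upper : J2 <= 4 * K.

Let H := r * p * J1.
Let q := expR (- (x / 4)).
(** The main contribution of the four sides together; the strip width is called [bb] here. Half the
    decay rate away from a side is [y]. *)
Let b := 2 * q ^+ 2 / H.
Let y := nu * H.

Let t_gt0 : 0 < t. Proof. exact: lt_le_trans t_ge1. Qed.
Let t2_gt0 : 0 < t ^+ 2. Proof. exact: exprn_gt0. Qed.
Let x_gt0 : 0 < x. Proof. by apply: lt_le_trans x_ge; rewrite divr_gt0. Qed.
Let J1_gt0 : 0 < J1. Proof. exact: lt_le_trans J1_lower. Qed.
Let e2_gt0 : 0 < eta ^+ 2. Proof. exact: exprn_gt0. Qed.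
Let J2_gt0 : 0 < J2. Proof. exact: lt_le_trans J2_lower. Qed.
Let H_gt0 : 0 < H. Proof. by rewrite !mulr_gt0. Qed.
Let q_gt0 : 0 < q. Proof. exact: expR_gt0. Qed.
Let b_gt0 : 0 < b. Proof. by rewrite divr_gt0// mulr_gt0// exprn_gt0. Qed.
Let y_gt0 : 0 < y. Proof. by rewrite mulr_gt0. Qed.
Let t_le_t2 : t <= t ^+ 2. Proof. by rewrite expr2 ler_peMr// ltW. Qed.

Let xJE : x / J2 = nu * r ^+ 2 * p.
Proof. by rewrite xE; field; rewrite gt_eqF. Qed.

Let bE : nu * q ^+ 2 = b * y / 2.
Proof. by rewrite /b /y; field; rewrite gt_eqF. Qed.

Let xJ_ge : t ^+ 2 / (8 * K) <= x / J2.
Proof.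
rewrite ler_pdivrMr ?mulr_gt0// mulrAC ler_pdivlMr//.
have h : x * J2 <= x * (4 * K) by rewrite ler_pM2l.
have h2 : t ^+ 2 * J2 <= 2 * x * (4 * K) by apply: ler_pM; rewrite ?(ltW t2_gt0) ?(ltW J2_gt0)//; move: x_ge; lra.
by lra.
Qed.

Let xJ_le : x / J2 <= 2 * t ^+ 2 / eta ^+ 2.
Proof.
rewrite ler_pM ?(ltW x_gt0) ?invr_ge0 ?(ltW J2_gt0)//.
by rewrite lef_pV2 ?posrE.
Qed.

Let m := eta / (8 * K).

Let m_gt0 : 0 < m. Proof. by rewrite divr_gt0// mulr_gt0. Qed.

(** As [r <= 1], [y] is at least [nu * r ^+ 2 * p * J1], which is [x / J2 * J1] and hence of order
    at least t^2. *)
Let y_ge : m * t <= y.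
Proof.
have h1 : nu * r ^+ 2 * p * J1 <= y.
  rewrite /y /H (_ : nu * (r * p * J1) = 1 * (nu * r * p * J1)); last by ring.
  rewrite (_ : nu * r ^+ 2 * p * J1 = r * (nu * r * p * J1)); last by ring.
  by rewrite ler_wpM2r// ltW// !mulr_gt0.
apply: le_trans h1; rewrite -xJE /m.
apply: (@le_trans _ _ (t ^+ 2 / (8 * K) * eta)).
  rewrite (_ : eta / (8 * K) * t = t * (eta / (8 * K))); last by ring.
  rewrite (_ : t ^+ 2 / (8 * K) * eta = t ^+ 2 * (eta / (8 * K))); last by ring.
  by rewrite ler_pM2r.
by apply: ler_pM => //; rewrite ?(ltW eta_gt0)// ltW// divr_gt0// mulr_gt0.
Qed.

Let iy_le : y^-1 <= m^-1 / t.
Proof. by rewrite -invfM lef_pV2 ?posrE// mulr_gt0. Qed.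

Let q_le : q <= 8 / t.
Proof.
have x4 : 0 < x / 4 by rewrite divr_gt0.
apply: le_trans (expRN_le_inv x4) _; rewrite invf_div.
rewrite ler_pdivrMr// mulrAC ler_pdivlMr//.
by move: x_ge t_le_t2; lra.
Qed.

(** Relative errors in units of 1 / t: 1/2, 2 and 2 multiples of [y^-1] from the truncated side
    integral, the opposite sides and the adjacent sides, and [2 * q <= 16 / t] from the products of
    centre and side. *)
Definition lower_cst := m^-1 * (9 / 2) + 16.

Lemma nu_outer_ge (N : R) :
  q ^+ 4 + 2 * q ^+ 2 * edge_mass (2 * nu * H) -
  (2 * q ^+ 3 * edge_mass (2 * nu * H / 2) + 2 * q ^+ 2 * expR (- (2 * nu * H / 2)) +
   q ^+ 2 * edge_mass (2 * nu * H / 2) ^+ 2) <= N ->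
  nu * q ^+ 4 + b * (1 - lower_cst / t) <= nu * N.
Proof.
rewrite -(ler_pM2l nu_gt0); apply: le_trans.
have -> : 2 * nu * H / 2 = y by rewrite /y; field.
have -> : 2 * nu * H = 2 * y by rewrite /y; ring.
have y20 : 0 < 2 * y by rewrite mulr_gt0.
have h1 : b * (1 - (2 * y)^-1) <= nu * (2 * q ^+ 2 * edge_mass (2 * y)).
  rewrite (_ : nu * _ = b * (1 - expR (- (2 * y)))).
    rewrite ler_pM2l// lerB//.
    exact: expRN_le_inv.
  rewrite (_ : nu * (2 * q ^+ 2 * edge_mass (2 * y)) = (nu * q ^+ 2) * (2 * edge_mass (2 * y))); last by ring.
  by rewrite bE /edge_mass; field; rewrite gt_eqF.
have S0 := edge_mass_ge0 y_gt0; have S1 := edge_mass_le y_gt0.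
have h2 : nu * (2 * q ^+ 3 * edge_mass y) <= b * (2 * q).
  rewrite (_ : nu * _ = (nu * q ^+ 2) * (2 * q) * edge_mass y); last by ring.
  rewrite (_ : b * (2 * q) = (nu * q ^+ 2) * (2 * q) * (2 / y)); last by rewrite bE; field; rewrite gt_eqF.
  by rewrite ler_pM2l// !mulr_gt0.
have h3 : nu * (2 * q ^+ 2 * expR (- y)) <= b * (2 / y).
  rewrite (_ : nu * _ = nu * q ^+ 2 * (2 * expR (- y))); last by ring.
  rewrite bE (_ : b * (2 / y) = b * y / 2 * (2 * (2 / y ^+ 2))); last by field; rewrite gt_eqF.
  have by0 : 0 <= b * y / 2 by rewrite ltW// divr_gt0// mulr_gt0.
  by apply: ler_wpM2l => //; apply: ler_wpM2l => //; exact: (expRN_le 1 y_gt0).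
have h4 : nu * (q ^+ 2 * edge_mass y ^+ 2) <= b * (2 / y).
  rewrite mulrA bE (_ : b * (2 / y) = b * y / 2 * (2 / y) ^+ 2); last by field; rewrite gt_eqF.
  apply: ler_wpM2l; first by rewrite ltW// divr_gt0// mulr_gt0.
  by apply: lerXn2r => //; rewrite nnegrE divr_ge0// ltW.
have h5 : b * y^-1 <= b * (m^-1 / t) by rewrite ler_pM2l.
have h6 : b * q <= b * (8 / t) by rewrite ler_pM2l.
rewrite (_ : (2 * y)^-1 = y^-1 / 2) in h1; last by field; rewrite gt_eqF.
rewrite /lower_cst mulrDl.
have -> : m^-1 * (9 / 2) / t = 9 / 2 * (m^-1 / t) by ring.
have -> : 16 / t = 2 * (8 / t) by ring.
by move: h1 h2 h3 h4 h5 h6; lra.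
Qed.

(** These three constants bound, after division by t, the tail exponent [8 * nu * tau], the relative
    error of the sides, and the corners. In [upper_edge], [2 / eta] pays for lowering the slope and
    the rest for the layer between [bb] and [c]. *)
Definition upper_exp := 16 * K / eta ^+ 2.
Definition upper_edge := 2 / eta + 4 * expR 1 * (K + 1) * (7`!%:R) / (eta ^+ 2 * m ^+ 7).
Definition upper_corner := 8 * expR 1 ^+ 2 * 13`!%:R * 8 ^+ 13 / (a1 * eta ^+ 2).

(** The fourth power outweighs the t^2 in [nu * r ^+ 2 * p], so tails beyond [c] vanish in the
    exponent. With [bb = r / t] the slope changes by a relative O(1 / t), while the decay
    accumulated over [bb] is still at least [m * t]. *)
Let c := t ^+ 4 * r.
Let bb := r / t.

Let c_gt0 : 0 < c. Proof. by rewrite mulr_gt0// exprn_gt0. Qed.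

Let bbp : bb * p = r * p / t. Proof. by rewrite /bb; ring. Qed.

Let it_le : t^-1 <= eta / 2.
Proof. by rewrite -[t^-1]mul1r ler_pdivrMr//; move: t_ge; lra. Qed.

Lemma strip_lt : bb * p < H.
Proof.
rewrite bbp /H ltr_pM2l ?mulr_gt0//; move: it_le J1_lower eta_gt0; lra.
Qed.

Lemma nu_outer_le (N : R) :
  N <= expR (8 * nu * (K * p * r * (r ^+ 2 / (r + c)))) *
  (q ^+ 4 + q ^+ 2 * (2 * edge_mass (2 * nu * (H - bb * p)) +
      expR (- (2 * nu * (H - bb * p) * bb)) * (2 * expR 1 * edge_mass c^-1)) +
    q * (expR 1 * edge_mass c^-1) ^+ 2) ->
  nu * N <= expR (upper_exp / t) *
    (nu * q ^+ 4 + b * (1 + upper_edge / t) + upper_corner / t).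
Proof.
rewrite -(ler_pM2l nu_gt0) => /le_trans; apply.
rewrite mulrCA.
have c10 : 0 < c^-1 by rewrite invr_gt0.
have Hb0 : 0 < H - bb * p by rewrite subr_gt0 strip_lt.
have Sc0 := edge_mass_ge0 c10; have Sc1 := edge_mass_le c10; rewrite invrK in Sc1.
have e10 : 0 < expR 1 :> R by exact: expR_gt0.
have E : expR (8 * nu * (K * p * r * (r ^+ 2 / (r + c)))) <= expR (upper_exp / t).
  rewrite ler_expR (_ : 8 * nu * _ = 8 * K * (x / J2) / (1 + t ^+ 4)); last first.
    rewrite xJE /c; field.
    by rewrite !gt_eqF// ?addr_gt0 ?mulr_gt0 ?exprn_gt0.
  have t4 : 0 < 1 + t ^+ 4 by rewrite addr_gt0 ?exprn_gt0.
  rewrite ler_pdivrMr//.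
  apply: (@le_trans _ _ (8 * K * (2 * t ^+ 2 / eta ^+ 2))); first by rewrite ler_pM2l ?mulr_gt0.
  rewrite /upper_exp (_ : 8 * K * _ = 16 * K / eta ^+ 2 * t ^+ 2); last by ring.
  rewrite -[leRHS]mulrA; apply: ler_wpM2l; first by rewrite ltW// divr_gt0// mulr_gt0.
  rewrite [leRHS]mulrC ler_pdivlMr//.
  have : 0 <= t ^+ 3 * (t - 1) by rewrite mulr_ge0 ?exprn_ge0 ?(ltW t_gt0)// subr_ge0.
  by rewrite !exprS expr0; lra.
have U_ge0 : 0 <= nu * q ^+ 4 by rewrite mulr_ge0 ?exprn_ge0// ltW.
apply: ler_pM E _; first exact: expR_ge0.
  have q0 := ltW q_gt0; have e0 := ltW e10.
  have Sk0 : 0 <= edge_mass (2 * nu * (H - bb * p)) by apply: edge_mass_ge0; rewrite !mulr_gt0.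
  apply: mulr_ge0; first exact: ltW.
  apply: addr_ge0; last by apply: mulr_ge0 => //; exact: sqr_ge0.
  apply: addr_ge0; first exact: exprn_ge0.
  apply: mulr_ge0; first exact: exprn_ge0.
  apply: addr_ge0; first exact: mulr_ge0.
  apply: mulr_ge0; first exact: expR_ge0.
  by apply: mulr_ge0 => //; exact: mulr_ge0.
(* With [z = (t * eta)^-1 <= 1 / 2], replacing [H] by [H - bb * p] costs at most a factor
   [1 / (1 - z) <= 1 + 2 * z]. *)
have h1 : nu * (q ^+ 2 * (2 * edge_mass (2 * nu * (H - bb * p)))) <= b * (1 + 2 / eta / t).
  have k0 : 0 < 2 * nu * (H - bb * p) by rewrite !mulr_gt0.
  have z0 : 0 < 1 - (t * eta)^-1.
    by rewrite subr_gt0 invf_lt1 ?mulr_gt0//; move: t_ge; lra.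
  apply: (@le_trans _ _ (2 * q ^+ 2 / (H - bb * p))).
    rewrite (_ : nu * _ = nu * q ^+ 2 * 2 * edge_mass (2 * nu * (H - bb * p))); last by ring.
    rewrite (_ : 2 * q ^+ 2 / _ = nu * q ^+ 2 * 2 * (2 / (2 * nu * (H - bb * p)))); last first.
      by field; rewrite !gt_eqF.
    by rewrite ler_pM2l ?edge_mass_le// !mulr_gt0// exprn_gt0.
  apply: (@le_trans _ _ (b / (1 - (t * eta)^-1))).
    rewrite /b -[2 * q ^+ 2 / H / _]mulrA -invfM ler_pM2l ?mulr_gt0 ?exprn_gt0//.
    rewrite lef_pV2 ?posrE ?mulr_gt0// bbp /H.
    rewrite (_ : r * p * J1 * _ = r * p * J1 - r * p / t * (J1 / eta)); last first.
      by field; rewrite !gt_eqF.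
    rewrite lerB// ler_peMr ?divr_ge0 ?mulr_ge0 ?(ltW r_gt0) ?(ltW p_gt0) ?(ltW t_gt0)//.
    by rewrite ler_pdivlMr// mul1r.
  rewrite ler_pdivrMr// -[leRHS]mulrA -[leLHS]mulr1; apply: ler_wpM2l; first exact: ltW.
  set z := (t * eta)^-1.
  have -> : 2 / eta / t = 2 * z by rewrite /z; field; rewrite !gt_eqF.
  have zz : z <= 2^-1 by rewrite lef_pV2 ?posrE ?mulr_gt0.
  have z1 : 0 <= z by rewrite invr_ge0 mulr_ge0 ?(ltW t_gt0) ?(ltW eta_gt0).
  have : 0 <= z * (1 - 2 * z) by rewrite mulr_ge0//; lra.
  by lra.
(* The exponential is at most 7! / (m t)^7, one power more than the t^6 contributed by [y * c]. *)
have h2 : nu * (q ^+ 2 * (expR (- (2 * nu * (H - bb * p) * bb)) * (2 * expR 1 * edge_mass c^-1))) <=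
   b * (4 * expR 1 * (K + 1) * (7`!%:R) / (eta ^+ 2 * m ^+ 7) / t).
  have mt0 : 0 < m * t by rewrite mulr_gt0.
  have e1 : expR (- (2 * nu * (H - bb * p) * bb)) <= 7`!%:R / (m * t) ^+ 7.
    apply: le_trans (expRN_le 6 mt0); rewrite ler_expR lerN2.
    rewrite bbp /H /bb (_ : 2 * nu * _ * _ = (x / J2) * (2 * (J1 - t^-1)) / t); last first.
      by rewrite xJE; field; rewrite gt_eqF.
    rewrite ler_pdivlMr// (_ : m * t * t = t ^+ 2 / (8 * K) * eta); last by rewrite /m; ring.
    apply: ler_pM => //; rewrite ?(ltW eta_gt0)//; first by rewrite ltW// divr_gt0// mulr_gt0.
    by move: it_le J1_lower; lra.
  have yc : y * c <= 2 * t ^+ 6 * (K + 1) / eta ^+ 2.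
    rewrite (_ : y * c = t ^+ 4 * (x / J2) * J1); last by rewrite xJE /y /c /H; ring.
    rewrite (_ : 2 * t ^+ 6 * (K + 1) / eta ^+ 2 = t ^+ 4 * (2 * t ^+ 2 / eta ^+ 2) * (K + 1)); last by ring.
    apply: ler_pM => //.
    - by rewrite mulr_ge0 ?exprn_ge0 ?(ltW t_gt0)// divr_ge0// ltW.
    - exact: ltW.
    - by rewrite ler_pM2l// exprn_gt0.
  rewrite (_ : nu * _ = b * (expR 1 * (expR (- (2 * nu * (H - bb * p) * bb)) * (y * edge_mass c^-1)))); last first.
    by rewrite mulrA bE; field.
  rewrite ler_pM2l//.
  have h : expR (- (2 * nu * (H - bb * p) * bb)) * (y * edge_mass c^-1) <=
     7`!%:R / (m * t) ^+ 7 * (2 * (2 * t ^+ 6 * (K + 1) / eta ^+ 2)).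
    apply: ler_pM => //; first by apply: mulr_ge0 => //; exact: ltW.
    apply: (@le_trans _ _ (2 * (y * c))); last exact: ler_wpM2l.
    by rewrite [leRHS]mulrCA; apply: ler_wpM2l => //; exact: ltW.
  apply: (@le_trans _ _ (expR 1 * (7`!%:R / (m * t) ^+ 7 * (2 * (2 * t ^+ 6 * (K + 1) / eta ^+ 2))))).
    by rewrite ler_pM2l.
  have mn0 := lt0r_neq0 m_gt0; have tn0 := lt0r_neq0 t_gt0; have en0 := lt0r_neq0 eta_gt0.
  move: (7`!%:R : R) mn0 => F7; move: m => m' mn0.
  by rewrite le_eqVlt; apply/orP; left; apply/eqP; field; rewrite ?mn0 ?tn0 ?en0.
(* By [p_ge] the factor [nu * r ^+ 2] is O(t^4), and [c ^+ 2] adds t^8. Bounding [q] by the 13th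
   power of 8 / t leaves 1 / t. *)
have h3 : nu * (q * (expR 1 * edge_mass c^-1) ^+ 2) <= upper_corner / t.
  have S2 : edge_mass c^-1 ^+ 2 <= (2 * c) ^+ 2.
    by rewrite lerXn2r ?nnegrE// mulr_ge0// ltW.
  have t80 : 0 < t / 8 by rewrite divr_gt0.
  have qq : q <= 13`!%:R / (t / 8) ^+ 13.
    apply: le_trans (expRN_le 12 t80); rewrite ler_expR lerN2.
    by move: x_ge t_le_t2; lra.
  have nr : nu * r ^+ 2 <= 2 * t ^+ 4 / (a1 * eta ^+ 2).
    rewrite (_ : nu * r ^+ 2 = x / J2 / p); last by rewrite xJE; field; rewrite gt_eqF.
    rewrite (_ : 2 * t ^+ 4 / _ = 2 * t ^+ 2 / eta ^+ 2 * (t ^+ 2 / a1)); last by field; rewrite !gt_eqF.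
    apply: ler_pM => //; first by rewrite ltW// divr_gt0.
      by rewrite invr_ge0 ltW.
    by rewrite -[p^-1]mul1r ler_pdivrMr// mulrAC ler_pdivlMr// mul1r mulrC.
  rewrite exprMn (_ : nu * _ = q * expR 1 ^+ 2 * nu * edge_mass c^-1 ^+ 2); last by ring.
  apply: (@le_trans _ _ (q * expR 1 ^+ 2 * nu * (2 * c) ^+ 2)).
    by rewrite ler_pM2l// !mulr_gt0// exprn_gt0.
  rewrite (_ : _ * (2 * c) ^+ 2 = q * (nu * r ^+ 2) * (4 * expR 1 ^+ 2 * t ^+ 8)); last by rewrite /c; ring.
  apply: (@le_trans _ _ (13`!%:R / (t / 8) ^+ 13 * (2 * t ^+ 4 / (a1 * eta ^+ 2)) * (4 * expR 1 ^+ 2 * t ^+ 8))).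
    rewrite ler_pM2r; last by rewrite !mulr_gt0// exprn_gt0.
    by apply: ler_pM => //; rewrite ?(ltW q_gt0)// mulr_ge0 ?sqr_ge0// ltW.
  rewrite /upper_corner.
  have tn0 := lt0r_neq0 t_gt0; have en0 := lt0r_neq0 eta_gt0; have an0 := lt0r_neq0 a1_gt0.
  move: (13`!%:R : R) => F13; move: (expR 1 : R) => e.
  by rewrite le_eqVlt; apply/orP; left; apply/eqP; field; rewrite ?an0 ?tn0 ?en0.
rewrite /upper_edge mulrDl.
by move: h1 h2 h3; lra.
Qed.

End estimates.

(** * Limits along sqrt (ln n) and the squeeze *)

Section limits.
Context {R : realType}.

Lemma cvg_ln_nat : (fun n : nat => ln (n%:R : R)) @ \oo --> +oo.
Proof.
apply/cvgryPge => A; near=> n.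
have n1 : expR A <= n%:R by near: n; exact: nbhs_infty_ger.
by rewrite -[A]expRK ler_ln// posrE ?expR_gt0// (lt_le_trans (expR_gt0 A)).
Unshelve. all: by end_near. Qed.

Lemma cvg_sqrt_ln_nat : (fun n : nat => Num.sqrt (ln (n%:R : R))) @ \oo --> +oo.
Proof.
apply/cvgryPge => A; near=> n.
have h : A ^+ 2 <= ln (n%:R : R) by near: n; exact: (cvgry_ge cvg_ln_nat).
by rewrite (le_trans (ler_norm A))// -sqrtr_sqr ler_wsqrtr.
Unshelve. all: by end_near. Qed.

Lemma cvg_div_sqrt_ln (C : R) : (fun n : nat => C / Num.sqrt (ln (n%:R : R))) @ \oo --> 0.
Proof.
rewrite -[X in _ --> X](mulr0 C); apply: cvgM; first exact: cvg_cst.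
apply/gtr0_cvgV0; last exact: cvg_sqrt_ln_nat.
by near=> n; near: n; exact: (cvgry_gt cvg_sqrt_ln_nat).
Unshelve. all: by end_near. Qed.

Lemma bigTheta_ge (f g : nat -> R) : f =Theta_\oo g ->
  exists2 k : R, 0 < k & \forall n \near \oo, k * `|g n| <= `|f n|.
Proof.
by move=> ->; have [h k1 k2 H1 _] := bigTheta; exists k1%:num.
Qed.

(** The weights [B] and [D] may oscillate. Being nonnegative with sum [alpha], each is at most
    [alpha], so a factor [v] tending to 1 changes the sum by at most [alpha * |v - 1|]. *)
Lemma cvg_sandwich_mixture (B D v1 v2 v3 v4 v5 Z : nat -> R) (alpha : R) :
  (forall n, (1 < n)%N -> [/\ 0 <= B n, 0 <= D n & B n + D n = alpha]) ->
  v1 @ \oo --> (1 : R) -> v2 @ \oo --> (1 : R) -> v3 @ \oo --> (1 : R) -> v4 @ \oo --> (1 : R) ->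
  v5 @ \oo --> (0 : R) ->
  (\forall n \near \oo, B n * v1 n + D n * v2 n <= Z n) ->
  (\forall n \near \oo, Z n <= B n * v3 n + D n * v4 n + v5 n) ->
  Z @ \oo --> alpha.
Proof.
move=> BD c1 c2 c3 c4 c5 lo hi.
have dist (u v : nat -> R) : u @ \oo --> (1 : R) -> v @ \oo --> (1 : R) ->
    (fun n => alpha * (`|u n - 1| + `|v n - 1|)) @ \oo --> (0 : R).
  move=> cu cv; rewrite -[X in _ --> X](mulr0 alpha); apply: cvgM; first exact: cvg_cst.
  rewrite -[X in _ --> X](addr0 0); apply: cvgD.
    have := cvg_norm (cvgB cu (cvg_cst (1 : R))); rewrite subrr normr0; exact.
  have := cvg_norm (cvgB cv (cvg_cst (1 : R))); rewrite subrr normr0; exact.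
have bnd n (u v : R) : (1 < n)%N ->
    `|B n * u + D n * v - alpha| <= alpha * (`|u - 1| + `|v - 1|).
  move=> /BD[B0 D0 BDa].
  rewrite -[X in _ - X]BDa (_ : _ - _ = B n * (u - 1) + D n * (v - 1)); last by ring.
  rewrite (le_trans (ler_normD _ _))// !normrM (ger0_norm B0) (ger0_norm D0) mulrDr.
  by apply: lerD; apply: ler_wpM2r => //; lra.
apply: (@squeeze_cvgr _ _ _ _ (fun n => alpha - alpha * (`|v1 n - 1| + `|v2 n - 1|))
  (fun n => alpha + alpha * (`|v3 n - 1| + `|v4 n - 1|) + v5 n)).
- near=> n; have n1 : (1 < n)%N by near: n; exact: nbhs_infty_gt.
  have l : B n * v1 n + D n * v2 n <= Z n by near: n.
  have h : Z n <= B n * v3 n + D n * v4 n + v5 n by near: n.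
  have := bnd n (v1 n) (v2 n) n1; have := bnd n (v3 n) (v4 n) n1.
  rewrite !ler_norml => /andP[_ a] /andP[b _].
  by apply/andP; split; lra.
- rewrite -[X in _ --> X](subr0 alpha); apply: cvgB; first exact: cvg_cst.
  exact: dist.
- rewrite -[X in _ --> X](addr0 alpha); apply: cvgD; last exact: c5.
  rewrite -[X in _ --> X](addr0 alpha); apply: cvgD; first exact: cvg_cst.
  exact: dist.
Unshelve. all: by end_near. Qed.

End limits.

(** * Exact form of the interior and side contributions *)

Section coefficients.
Context {R : realType}.
Variables (nu x gamma o p r J1 J2 : R).
Hypothesis nu_gt1 : 1 < nu.
Hypothesis gamma_gt0 : 0 < gamma.
Hypothesis p_gt0 : 0 < p.
Hypothesis r_gt0 : 0 < r.
Hypothesis J1_gt0 : 0 < J1.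
Hypothesis J2_gt0 : 0 < J2.
Hypothesis xE : x = nu * (r ^+ 2 * p * J2).
Hypothesis xo : x = ln nu - 2 * ln gamma + o.

Let nu_gt0 : 0 < nu. Proof. exact: lt_trans nu_gt1. Qed.

Let expx2 : expR (- (x / 4)) ^+ 2 = expR (- (ln nu / 2)) * gamma * expR (- (o / 2)).
Proof.
rewrite -expRM_natl (_ : 2 * - (x / 4) = - (ln nu / 2) + ln gamma + - (o / 2)); last by rewrite xo; field.
by rewrite !expRD lnK// posrE.
Qed.

Let expL2 : expR (- (ln nu / 2)) ^+ 2 = nu^-1.
Proof.
by rewrite -expRM_natl (_ : 2 * - (ln nu / 2) = - ln nu) ?expRN ?lnK ?posrE//; field.
Qed.

Lemma interior_coefE : nu * expR (- (x / 4)) ^+ 4 = gamma ^+ 2 * expR (- o).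
Proof.
rewrite (_ : _ ^+ 4 = (expR (- (x / 4)) ^+ 2) ^+ 2); last by rewrite -exprM.
rewrite expx2 !exprMn expL2 -[expR (- (o / 2)) ^+ 2]expRM_natl (_ : 2 * - (o / 2) = - o); last by field.
by rewrite !mulrA divff ?mul1r// gt_eqF.
Qed.

(** By [xE], [1 / (nu * r ^+ 2 * p ^+ 2)] is [J2 / (p * x)], which eliminates [r]. The equation for
    gamma has [ln nu] where this has [x], hence the factor [sqrt (ln nu / x)]. *)
Lemma edge_coefE : 2 * expR (- (x / 4)) ^+ 2 / (r * p * J1) =
  gamma * (2 * (Num.sqrt J2 / J1) * (p * ln nu) `^ (- 2^-1)) *
  (expR (- (o / 2)) * Num.sqrt (ln nu / x)).
Proof.
have L0 : 0 < ln nu by exact: ln_gt0.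
have pL0 : 0 < p * ln nu by rewrite mulr_gt0.
have eL := expL2; have ex := expx2; set E := expR (- (ln nu / 2)) in eL ex.
have E0 : 0 < E by exact: expR_gt0.
have key : Num.sqrt J2 * (Num.sqrt (p * ln nu))^-1 * Num.sqrt (ln nu / x) = E / (r * p).
  have e : J2 * (p * ln nu)^-1 * (ln nu / x) = (E / (r * p)) ^+ 2.
    rewrite expr_div_n eL xE.
    have n0 := lt0r_neq0 nu_gt0; have p0 := lt0r_neq0 p_gt0; have r0 := lt0r_neq0 r_gt0.
    have j0 := lt0r_neq0 J2_gt0; have l0 := lt0r_neq0 L0.
    by field; rewrite ?n0 ?p0 ?r0 ?j0 ?l0.
  have j0 : 0 <= J2 by exact: ltW.
  have jp0 : 0 <= J2 * (p * ln nu)^-1 by rewrite mulr_ge0// invr_ge0 ltW.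
  rewrite -sqrtrV ?(ltW pL0)// -(sqrtrM _ j0) -(sqrtrM _ jp0) e sqrtr_sqr ger0_norm//.
  by rewrite divr_ge0 ?mulr_ge0 ?(ltW E0) ?(ltW r_gt0) ?(ltW p_gt0).
rewrite powRN powR12_sqrt ?(ltW pL0)// ex.
rewrite [RHS](_ : _ = 2 * gamma * expR (- (o / 2)) / J1 *
  (Num.sqrt J2 * (Num.sqrt (p * ln nu))^-1 * Num.sqrt (ln nu / x))); last by ring.
rewrite key.
have p0 := lt0r_neq0 p_gt0; have r0 := lt0r_neq0 r_gt0; have j0 := lt0r_neq0 J1_gt0.
by field; rewrite ?p0 ?r0 ?j0.
Qed.

End coefficients.

(** * Bounds on gamma and passage to the limit *)

Lemma quadratic_root_bounds {R : realType} (alpha g k K0 : R) :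
  0 < g -> 0 <= k -> k <= K0 -> g ^+ 2 + g * k = alpha ->
  alpha / (1 + alpha + K0) <= g <= 1 + alpha.
Proof.
move=> g0 k0 kK E.
have a0 : 0 < alpha by rewrite -E ltr_wpDr ?exprn_gt0// mulr_ge0// ltW.
(* A larger root would already have a square above [alpha]. The lower bound then reads off from
   [g = alpha / (g + k)]. *)
have g1 : g <= 1 + alpha.
  rewrite leNgt; apply/negP => h.
  have : alpha < g ^+ 2.
    have : 1 * (1 + alpha) < g * g by apply: ltr_pM; lra.
    by rewrite expr2; lra.
  have : 0 <= g * k by rewrite mulr_ge0// ltW.
  by lra.
rewrite g1 andbT ler_pdivrMr; last lra.
have : g * (g + k) <= g * (1 + alpha + K0) by rewrite ler_pM2l//; lra.
by move: E; rewrite expr2; lra.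
Qed.

Lemma natr_powRN {R : realType} (c : R) (n : nat) : (0 < n)%N ->
  n%:R `^ (- c) = expR (- (c * ln n%:R)).
Proof. by move=> n0; rewrite /powR pnatr_eq0 gtn_eqF// mulNr. Qed.

Theorem theorem8p1 (R : realType) (alpha eta : R)
  (phi : nat -> R * R -> R) (gamma : nat -> R)
  (alpha_gt0 : 0 < alpha) (eta_gt0 : 0 < eta) (eta_le1 : eta <= 1)
  (phi_class : forall n, (0 < n)%N -> Phi2 eta (phi n) /\ Psi2 (phi n))
  (r_small : exists2 c : R, 0 < c &
     \forall n \near \oo, rho eta (phi n) <= n%:R `^ (- c))
  (p_Theta : (fun n => conn_sup (phi n)) =Theta_\oo (fun n => 1 / ln n%:R))
  (gamma_sol : forall n, (1 < n)%N ->
     0 < gamma n /\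
     gamma n ^+ 2 +
       2 * gamma n * (Num.sqrt (J2 eta (phi n)) / J1 eta (phi n)) *
       (conn_sup (phi n) * ln n%:R) `^ (- 2^-1) = alpha)
  (mean_degree :
     (fun n => n%:R * conn_integral (phi n) - (ln n%:R - 2 * ln (gamma n)))
       @ \oo --> (0 : R)) :
  (fun n => n%:R * \int[leb2 R]_(x in @unit_square R)
     expR (- (n%:R * \int[leb2 R]_(y in @unit_square R) phi n (y - x))))
    @ \oo --> alpha.
Proof.
have [C C0 hC] := expR_powR_decay eta_gt0.
set K := 3 / eta * C.
have K0 : 0 < K by rewrite mulr_gt0// divr_gt0.
have [c c0 hr] := r_small.
have [a1 a10 hp] := bigTheta_ge p_Theta.
pose P n := conn_sup (phi n); pose r n := rho eta (phi n).
pose j1 n := J1 eta (phi n); pose j2 n := J2 eta (phi n).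
pose L n : R := ln n%:R; pose T n := Num.sqrt (L n).
pose X n := n%:R * conn_integral (phi n).
pose o n := X n - (L n - 2 * ln (gamma n)).
(* [k n] is the linear coefficient of the quadratic equation, and [s n] measures the effect of [X n]
   standing in place of [L n]. *)
pose k n := 2 * (Num.sqrt (j2 n) / j1 n) * (P n * L n) `^ (- 2^-1).
pose s n := Num.sqrt (L n / X n).
have facts n : (0 < n)%N -> [/\ 0 < P n, 0 < r n, eta <= j1 n <= K + 1,
    eta ^+ 2 <= j2 n <= 4 * K & X n = n%:R * (r n ^+ 2 * P n * j2 n)].
  move=> /phi_class[h1 h2]; split.
  - exact: conn_sup_gt0 eta_gt0 h1.
  - exact: rho_gt0 h1.
  - by rewrite (J1_ge eta_gt0 h1 h2 C0 hC) (J1_le eta_gt0 h1 h2 C0 hC).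
  - by rewrite (J2_ge eta_gt0 h1 h2 C0 hC) (J2_le eta_gt0 h1 h2 C0 hC).
  - by rewrite /X (conn_integralE eta_gt0 h1 h2 C0 hC).
have sol n : (1 < n)%N -> gamma n ^+ 2 + gamma n * k n = alpha.
  by move=> /gamma_sol[_ <-]; rewrite /k /P /L /j1 /j2; ring.
have k_ge0 n : (1 < n)%N -> 0 <= k n.
  move=> n1; have [_ _ /andP[j _] _ _] := facts n (ltnW n1).
  by rewrite mulr_ge0 ?powR_ge0// mulr_ge0// divr_ge0 ?sqrtr_ge0// (le_trans (ltW eta_gt0)).
have cL : L @ \oo --> +oo := cvg_ln_nat.
have cT : T @ \oo --> +oo := cvg_sqrt_ln_nat.
have oE : o @ \oo --> (0 : R) by exact: mean_degree.
(* The value of [k n] with [j2 n], [j1 n] and [P n * L n] replaced by their bounds [4 * K], [eta]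
   and [a1]. *)
pose K1 := 2 * (Num.sqrt (4 * K) / eta) * (Num.sqrt a1)^-1.
have near_p : \forall n \near \oo, a1 <= P n * L n.
  near=> n; have L0 : 0 < L n by near: n; exact: (cvgry_gt cL).
  have n0 : (0 < n)%N by near: n; exact: nbhs_infty_gt.
  have [p0 _ _ _ _] := facts n n0.
  have : a1 * `|1 / ln n%:R| <= `|conn_sup (phi n)| by near: n.
  by rewrite mul1r !gtr0_norm ?invr_gt0// ler_pdivrMr.
have near_k : \forall n \near \oo, k n <= K1.
  near=> n; have L0 : 0 < L n by near: n; exact: (cvgry_gt cL).
  have n0 : (0 < n)%N by near: n; exact: nbhs_infty_gt.
  have ap : a1 <= P n * L n by near: n.
  have [p0 _ /andP[j1e _] /andP[_ j2K] _] := facts n n0.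
  have j10 : 0 < j1 n by exact: lt_le_trans j1e.
  rewrite /k /K1 powRN powR12_sqrt ?(le_trans (ltW a10))//.
  apply: ler_pM.
  - by rewrite mulr_ge0// divr_ge0 ?sqrtr_ge0// ltW.
  - by rewrite invr_ge0 sqrtr_ge0.
  - apply: ler_wpM2l => //; apply: ler_pM; rewrite ?sqrtr_ge0 ?invr_ge0 ?(ltW j10)//.
      exact: ler_wsqrtr.
    by rewrite lef_pV2 ?posrE.
  - by rewrite lef_pV2 ?posrE ?sqrtr_gt0 ?(lt_le_trans a10)// ler_wsqrtr.
pose g0 := alpha / (1 + alpha + K1).
have K10 : 0 <= K1.
  by rewrite mulr_ge0 ?invr_ge0 ?sqrtr_ge0// mulr_ge0// divr_ge0 ?sqrtr_ge0// ltW.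
have g00 : 0 < g0 by rewrite divr_gt0//; lra.
pose G := 2 * (`|ln g0| + `|ln (1 + alpha)|) + 1.
have G0 : 0 < G by rewrite /G; have := normr_ge0 (ln g0); have := normr_ge0 (ln (1 + alpha)); lra.
(* [X n - L n] is [o n - 2 * ln (gamma n)]. Bounds on gamma away from 0 and infinity make it
   bounded, so [X n / L n] tends to 1. *)
have near_X : \forall n \near \oo, `|X n - L n| <= G.
  near=> n; have n1 : (1 < n)%N by near: n; exact: nbhs_infty_gt.
  have kK : k n <= K1 by near: n.
  have [gn0 _] := gamma_sol n n1.
  have /andP[gl gu] := quadratic_root_bounds gn0 (k_ge0 n n1) kK (sol n n1).
  have on1 : `|o n| <= 1.
    by near: n; move/cvgr0Pnorm_le : oE; apply.
  have ll : ln g0 <= ln (gamma n) by rewrite ler_ln// posrE.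
  have lu : ln (gamma n) <= ln (1 + alpha) by rewrite ler_ln// posrE//; lra.
  have XE : X n - L n = o n - 2 * ln (gamma n) by rewrite /o; ring.
  move: on1; rewrite XE !ler_norml => /andP[oa ob]; rewrite /G.
  have := ler_norm (ln (1 + alpha)); have := ler_norm (- ln g0); rewrite normrN.
  have := normr_ge0 (ln g0); have := normr_ge0 (ln (1 + alpha)).
  by move=> n1' n2' n3' n4'; apply/andP; split; lra.
have cs : s @ \oo --> (1 : R).
  have cGL : (fun n => G / L n) @ \oo --> (0 : R).
    rewrite -[X in _ --> X](mulr0 G); apply: cvgM; first exact: cvg_cst.
    apply/gtr0_cvgV0; last exact: cL.
    by near=> n; near: n; exact: (cvgry_gt cL).
  have cXL : (fun n => X n / L n) @ \oo --> (1 : R).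
    apply: (@squeeze_cvgr _ _ _ _ (fun n => 1 - G / L n) (fun n => 1 + G / L n)).
    - near=> n; have L0 : 0 < L n by near: n; exact: (cvgry_gt cL).
      have : `|X n - L n| <= G by near: n.
      rewrite ler_norml => /andP[x1 x2].
      have Ln0 := lt0r_neq0 L0.
      have -> : 1 - G / L n = (L n - G) / L n by field.
      have -> : 1 + G / L n = (L n + G) / L n by field.
      by apply/andP; split; rewrite ler_pM2r ?invr_gt0//; lra.
    - by rewrite -[X in _ --> X](subr0 1); apply: cvgB => //; exact: cvg_cst.
    - by rewrite -[X in _ --> X](addr0 1); apply: cvgD => //; exact: cvg_cst.
  have : (fun n => Num.sqrt (X n / L n)^-1) @ \oo --> Num.sqrt (1^-1 : R).
    apply: (@cvg_comp _ _ _ (fun n => (X n / L n)^-1) (@Num.sqrt R)); last exact: sqrt_continuous.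
    by apply: cvgV => //; exact: oner_neq0.
  rewrite invr1 sqrtr1; apply: cvg_trans; apply: near_eq_cvg.
  by near=> n; rewrite /s invf_div.
pose lc := lower_cst eta K; pose uu := upper_exp eta K.
pose ue := upper_edge eta K; pose uc := upper_corner eta a1.
have good : \forall n \near \oo, [/\ (1 < n)%N, 1 <= T n, 2 <= T n * eta,
   (T n ^+ 2 / 2 <= X n <= 2 * T n ^+ 2) && (a1 <= P n * T n ^+ 2) &
   (r n <= 1) && (T n ^+ 4 * r n <= 2^-1)].
  near=> n.
  have n1 : (1 < n)%N by near: n; exact: nbhs_infty_gt.
  have L1 : 1 <= L n by near: n; exact: (cvgry_ge cL).
  have LG : 2 * G <= L n by near: n; exact: (cvgry_ge cL).
  have T1 : 1 <= T n by near: n; exact: (cvgry_ge cT).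
  have T2 : 2 / eta <= T n by near: n; exact: (cvgry_ge cT).
  (* From exp (- c T) <= 5! / (c T)^5 and [T n <= L n], this makes [T n ^+ 4 * r n] at most 1/2, as
     required of the corner width. *)
  have T3 : 2 * (5`!%:R / c ^+ 5) <= T n by near: n; exact: (cvgry_ge cT).
  have T0 : 0 < T n by exact: lt_le_trans T1.
  have TL : T n ^+ 2 = L n by rewrite sqr_sqrtr//; lra.
  have : `|X n - L n| <= G by near: n.
  rewrite ler_norml => /andP[x1 x2].
  have rn : r n <= n%:R `^ (- c) by near: n.
  rewrite natr_powRN ?(ltnW n1)// -/(L n) in rn.
  split => //.
  - by rewrite ler_pdivrMr in T2.
  - rewrite TL; apply/andP; split; first by apply/andP; split; lra.
    by near: n.
  - apply/andP; split.
      by apply: (le_trans rn); rewrite expR_le1 oppr_le0 mulr_ge0 ?(ltW c0)//; lra.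
    have cT0 : 0 < c * T n by rewrite mulr_gt0.
    have TT : T n <= L n by rewrite -TL expr2 ler_peMr// ltW.
    apply: (@le_trans _ _ (T n ^+ 4 * (5`!%:R / (c * T n) ^+ 5))).
      apply: ler_wpM2l; first by rewrite exprn_ge0// ltW.
      apply: le_trans rn _; apply: le_trans (expRN_le 4 cT0).
      by rewrite ler_expR lerN2 ler_wpM2l// ltW.
    have tn := lt0r_neq0 T0; have cn := lt0r_neq0 c0.
    have e5 (F t' : R) : t' != 0 -> t' ^+ 4 * (F / (c * t') ^+ 5) = F / c ^+ 5 / t'.
      by move=> t'0; field; rewrite t'0 cn.
    rewrite (e5 _ _ tn).
    by rewrite ler_pdivrMr//; lra.
have cexp (m : R) : (fun n => expR (- (m * o n))) @ \oo --> (1 : R).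
  have h : (fun n => - (m * o n)) @ \oo --> (0 : R).
    rewrite (_ : 0 = - (m * 0)); last by rewrite mulr0 oppr0.
    by apply: cvgN; apply: cvgM; [exact: cvg_cst|exact: oE].
  rewrite -[X in _ --> X](@expR0 R).
  by apply: (@cvg_comp _ _ _ (fun n => - (m * o n)) (@expR R) _ _ _ h); exact: continuous_expR.
have cu : (fun n => expR (uu / T n)) @ \oo --> (1 : R).
  rewrite -[X in _ --> X](@expR0 R).
  apply: (@cvg_comp _ _ _ (fun n => uu / T n) (@expR R)); last exact: continuous_expR.
  exact: cvg_div_sqrt_ln.
have c1m (a : R) : (fun n => 1 + a / T n) @ \oo --> (1 : R).
  rewrite -[X in _ --> X](addr0 1); apply: cvgD; first exact: cvg_cst.
  exact: cvg_div_sqrt_ln.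
have ceh : (fun n => expR (- (2^-1 * o n)) * s n) @ \oo --> (1 : R).
  by rewrite -[X in _ --> X](mulr1 1); apply: cvgM => //; exact: cexp.
apply: (@cvg_sandwich_mixture R (fun n => gamma n ^+ 2) (fun n => gamma n * k n)
  (fun n => expR (- (1 * o n)))
  (fun n => expR (- (2^-1 * o n)) * s n * (1 + - lc / T n))
  (fun n => expR (uu / T n) * expR (- (1 * o n)))
  (fun n => expR (uu / T n) * (expR (- (2^-1 * o n)) * s n * (1 + ue / T n)))
  (fun n => expR (uu / T n) * (uc / T n))).
- move=> n n1; split; [exact: sqr_ge0| |exact: sol].
  by rewrite mulr_ge0 ?k_ge0//; have [/ltW] := gamma_sol n n1.
- exact: cexp.
- by rewrite -[X in _ --> X](mulr1 1); apply: cvgM.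
- by rewrite -[X in _ --> X](mulr1 1); apply: cvgM => //; exact: cexp.
- rewrite -[X in _ --> X](mulr1 1); apply: cvgM => //.
  by rewrite -[X in _ --> X](mulr1 1); apply: cvgM.
- rewrite -[X in _ --> X](mulr0 1); apply: cvgM => //.
  exact: cvg_div_sqrt_ln.
- apply: filterS good => n [n1 T1 T2 /andP[/andP[X1 X2] pT] /andP[r1 cT2]].
  have n0 := ltnW n1; have [p0 r0 /andP[j1a j1b] /andP[j2a j2b] XE] := facts n n0.
  have nR1 : 1 < n%:R :> R by rewrite ltr1n.
  have nR0 : 0 < n%:R :> R by rewrite ltr0n.
  have j10 : 0 < j1 n := lt_le_trans eta_gt0 j1a.
  have j20 : 0 < j2 n := lt_le_trans (exprn_gt0 2 eta_gt0) j2a.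
  have [gn0 _] := gamma_sol n n1; have [h1 h2] := phi_class n n0.
  have xo : X n = ln n%:R - 2 * ln (gamma n) + o n by rewrite /o /L; ring.
  have := conn_outer_ge eta_gt0 h1 h2 C0 hC nR0; rewrite /= mulrA -/(X n).
  move=> /(nu_outer_ge eta_gt0 K0 p0 r0 r1 nR0 T1 X1 XE j1a j2a j2b).
  apply: le_trans; rewrite (interior_coefE nR1 gn0 xo).
  rewrite (edge_coefE nR1 gn0 p0 r0 j10 j20 XE xo) mul1r [2^-1 * o n]mulrC.
  by rewrite le_eqVlt; apply/orP; left; apply/eqP; rewrite /lc /k /s /L; ring.
- apply: filterS good => n [n1 T1 T2 /andP[/andP[X1 X2] pT] /andP[r1 cT2]].
  have n0 := ltnW n1; have [p0 r0 /andP[j1a j1b] /andP[j2a j2b] XE] := facts n n0.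
  have nR1 : 1 < n%:R :> R by rewrite ltr1n.
  have nR0 : 0 < n%:R :> R by rewrite ltr0n.
  have T0 : 0 < T n by exact: lt_le_trans T1.
  have j10 : 0 < j1 n := lt_le_trans eta_gt0 j1a.
  have j20 : 0 < j2 n := lt_le_trans (exprn_gt0 2 eta_gt0) j2a.
  have [gn0 _] := gamma_sol n n1; have [h1 h2] := phi_class n n0.
  have xo : X n = ln n%:R - 2 * ln (gamma n) + o n by rewrite /o /L; ring.
  have cc0 : 0 < T n ^+ 4 * r n by rewrite mulr_gt0// exprn_gt0.
  have b0 : 0 <= r n / T n by rewrite divr_ge0// ltW.
  have sl := strip_lt eta_gt0 p0 r0 T1 T2 j1a.
  have := conn_outer_le eta_gt0 h1 h2 C0 hC nR0 cc0 cT2 b0 sl; rewrite /= mulrA -/(X n).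
  move=> /(nu_outer_le eta_gt0 K0 a10 p0 r0 nR0 T1 T2 X1 X2 XE pT j1a j1b j2a j2b) h.
  apply: (le_trans h); rewrite (interior_coefE nR1 gn0 xo).
  rewrite (edge_coefE nR1 gn0 p0 r0 j10 j20 XE xo) mul1r [2^-1 * o n]mulrC.
  by rewrite le_eqVlt; apply/orP; left; apply/eqP; rewrite /uu /ue /uc /k /s /L; ring.
Unshelve. all: by end_near. Qed.
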